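(* For every nonempty compact metrizable space $Z$ there is a Peano graph $X$ with ground space $\operatorname{Gr}(X)=Z$ (as a subspace). Moreover, for any $x,y\in Z$, $X$ can be chosen so that (1) $X$ is Eulerian, or alternatively so that (2) $X$ is open Eulerian from $x$ to $y$, i.e. there is a strongly irreducible continuous surjection $g:[0,1]\to X$ with $g(0)=x$ and $g(1)=y$.
   Context: A Peano continuum is a compact connected locally connected metrizable space; a free arc (edge) is an inclusion-maximal open subset homeomorphic to $(0,1)$; $\operatorname{Gr}(X)$ is $X$ minus the union of all edges; a Peano graph is a Peano continuum in which the union of edges is dense. A continuous surjection $g:K\to X$ ($K=S^1$ or $[0,1]$) is strongly irreducible if $g(A)\neq X$ for every closed $A\subsetneq K$; $X$ is Eulerian if there is such a map with $K=S^1$. *)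

(* Defs.v *)
From Stdlib Require Import Reals List.
Open Scope R_scope.

Section Metric.
Variable M : Type.
Variable d : M -> M -> R.

Definition is_metric : Prop :=
  (forall x y, 0 <= d x y) /\
  (forall x y, d x y = 0 <-> x = y) /\
  (forall x y, d x y = d y x) /\
  (forall x y z, d x z <= d x y + d y z).

Definition subset (A B : M -> Prop) : Prop := forall x, A x -> B x.

Definition open (U : M -> Prop) : Prop :=
  forall x, U x -> exists r, 0 < r /\ forall y, d x y < r -> U y.

Definition rel_open (A U : M -> Prop) : Prop :=
  subset U A /\
  forall x, U x -> exists r, 0 < r /\ forall y, A y -> d x y < r -> U y.

Definition rel_closed (A C : M -> Prop) : Prop :=
  subset C A /\
  forall x, A x -> (forall r, 0 < r -> exists y, C y /\ d x y < r) -> C x.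

Definition connected_set (A : M -> Prop) : Prop :=
  forall U V, rel_open A U -> rel_open A V ->
    (forall x, A x -> U x \/ V x) ->
    (exists x, U x) -> (exists x, V x) ->
    exists x, U x /\ V x.

Definition connected_space : Prop := connected_set (fun _ => True).

Definition locally_connected : Prop :=
  forall x U, open U -> U x ->
    exists V, open V /\ V x /\ subset V U /\ connected_set V.

Definition compact_space : Prop :=
  forall F : (M -> Prop) -> Prop,
    (forall U, F U -> open U) ->
    (forall x, exists U, F U /\ U x) ->
    exists l : list (M -> Prop),
      (forall U, In U l -> F U) /\ (forall x, exists U, In U l /\ U x).

Definition dense (A : M -> Prop) : Prop :=
  forall x r, 0 < r -> exists y, A y /\ d x y < r.

Definition Peano_continuum : Prop :=
  is_metric /\ compact_space /\ connected_space /\ locally_connected.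
End Metric.

Arguments subset {M} A B.

Definition continuous_on {X Y : Type} (dX : X -> X -> R) (dY : Y -> Y -> R)
  (A : X -> Prop) (f : X -> Y) : Prop :=
  forall x, A x -> forall eps, 0 < eps -> exists delta, 0 < delta /\
    forall y, A y -> dX x y < delta -> dY (f x) (f y) < eps.

Definition homeo_sets {X Y : Type} (dX : X -> X -> R) (dY : Y -> Y -> R)
  (A : X -> Prop) (B : Y -> Prop) (f : X -> Y) : Prop :=
  (forall x, A x -> B (f x)) /\
  (forall y, B y -> exists x, A x /\ f x = y) /\
  (forall x x', A x -> A x' -> f x = f x' -> x = x') /\
  continuous_on dX dY A f /\
  (forall x, A x -> forall eps, 0 < eps -> exists delta, 0 < delta /\
     forall x', A x' -> dY (f x) (f x') < delta -> dX x x' < eps).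

Definition Rdist (a b : R) : R := Rabs (a - b).
Definition open_unit_interval (t : R) : Prop := 0 < t < 1.
Definition unit_interval (t : R) : Prop := 0 <= t <= 1.

Definition R2dist (p q : R * R) : R :=
  sqrt ((fst p - fst q) ^ 2 + (snd p - snd q) ^ 2).
Definition circle (p : R * R) : Prop := fst p ^ 2 + snd p ^ 2 = 1.

Section Graphs.
Variable X : Type.
Variable d : X -> X -> R.

Definition open_arc (E : X -> Prop) : Prop :=
  open X d E /\ exists h : R -> X, homeo_sets Rdist d open_unit_interval E h.

Definition free_arc (E : X -> Prop) : Prop :=
  open_arc E /\
  forall E', open_arc E' -> subset E E' -> subset E' E.

Definition edge_union (x : X) : Prop := exists E, free_arc E /\ E x.

Definition Gr (x : X) : Prop := ~ edge_union x.

Definition Peano_graph : Prop :=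
  Peano_continuum X d /\ dense X d edge_union.

Definition strongly_irreducible {T : Type} (dK : T -> T -> R) (K : T -> Prop)
  (g : T -> X) : Prop :=
  continuous_on dK d K g /\
  (forall y, exists t, K t /\ g t = y) /\
  (forall A, rel_closed T dK K A -> (exists t, K t /\ ~ A t) ->
     exists y, forall t, A t -> g t <> y).

Definition Eulerian : Prop :=
  exists g : R * R -> X, strongly_irreducible R2dist circle g.

Definition open_Eulerian (a b : X) : Prop :=
  exists g : R -> X, strongly_irreducible Rdist unit_interval g /\
    g 0 = a /\ g 1 = b.
End Graphs.

(* Main.v *)
(* Let C be the Cantor set.  A continuous surjection phi : C -> Z with
   phi 0 = x and phi 1 = y glues [0,1] to Z along C; call the result X and let
   g : [0,1] -> X be the quotient map.  As C is nowhere dense and g is injective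
   off C, g is strongly irreducible, and X is a Peano continuum as an image of
   [0,1].  The gaps of C become open arcs; they are maximal, and Z is exactly the
   ground space, as soon as no point of Z has an arc as neighbourhood.  This is
   enforced by choosing phi so that gaps whose two ends have the same image are
   dense: they become arbitrarily small loops near every point of Z, and an arc
   contains no loop.  For x = y the curve g closes up to a map on the circle.

   X is realized inside the bounded functions on Z + R with the sup metric: phi,
   followed by the Kuratowski embedding z |-> d(z, .), is interpolated linearly
   over the gaps, and the R-coordinates record the position in [0,1] with C
   collapsed to a point.  The map phi comes from a binary tree of points of Z
   whose steps shrink, read along tent-map (Gray code) addresses in C. *)

Require Import Defs.
From Stdlib Require Import Reals List.
From Stdlib Require Import Lra Lia Classical FunctionalExtensionality ClassicalEpsilon.
From Stdlib Require Cantor.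
Open Scope R_scope.

(** The delicate point is to get dense loops, surjectivity and continuity of phi from one tree. The
    tree offers one candidate point per level, so the step allowed at level k cannot be prescribed,
    say as 2^-k: it has to shrink as slowly as the candidates fill [Z], and such steps need not be
    summable. A candidate is therefore compared with all ancestors rather than with the last one
    only, which bounds the distance from a node to any descendant directly. Every second level
    idles: its letter has no effect. Under tent-map coding the two ends of a gap are both the
    parameter 1 of their subintervals, so their addresses differ in one letter, and at an idle level
    that letter does not change the image. Interpolation over a gap takes place between functions
    because [Z] has no linear structure; over a loop gap it is constant, so a second family of
    coordinates has to keep the gap an arc. *)

(** * Completeness of R and covering arguments on intervals *)

Lemma sup_exists (E : R -> Prop) (B x0 : R) :
  (forall x, E x -> x <= B) -> E x0 ->
  exists s, (forall x, E x -> x <= s) /\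
    (forall b, (forall x, E x -> x <= b) -> s <= b).
Proof.
  intros HB Hx0.
  destruct (completeness E) as [s [Hs1 Hs2]].
  - exists B. exact HB.
  - exists x0. exact Hx0.
  - exists s. split; [exact Hs1 | exact Hs2].
Qed.

Lemma inf_exists (E : R -> Prop) (B x0 : R) :
  (forall x, E x -> B <= x) -> E x0 ->
  exists s, (forall x, E x -> s <= x) /\
    (forall b, (forall x, E x -> b <= x) -> b <= s).
Proof.
  intros HB Hx0.
  destruct (sup_exists (fun x => E (- x)) (- B) (- x0)) as [s [Hs1 Hs2]].
  - intros x Hx. specialize (HB _ Hx). lra.
  - now rewrite Ropp_involutive.
  - exists (- s). split.
    + intros x Hx. assert (- x <= s); [|lra].
      apply Hs1. now rewrite Ropp_involutive.
    + intros b Hb. assert (s <= - b); [|lra].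
      apply Hs2. intros x Hx. specialize (Hb _ Hx). lra.
Qed.

Lemma Rle_of_eps (a b : R) : (forall e, 0 < e -> a <= b + e) -> a <= b.
Proof.
  intros H. destruct (Rle_dec a b) as [|n]; [assumption|].
  specialize (H ((a - b) / 2)). lra.
Qed.

Lemma Rabs_eq0_of_eps (a b : R) : (forall e, 0 < e -> Rabs (a - b) <= e) -> a = b.
Proof.
  intros H. destruct (Req_dec a b) as [|n]; [assumption|].
  assert (0 < Rabs (a - b)) by (apply Rabs_pos_lt; lra).
  specialize (H (Rabs (a - b) / 2)). lra.
Qed.

(* Cousin's lemma: the single compactness principle for intervals behind all
   the covering, connectedness and minimum arguments below. *)
Lemma interval_local_to_global (Q : R -> R -> Prop) (a b : R) :
  a <= b ->
  (forall u v w, a <= u -> u <= v -> v <= w -> w <= b -> Q u v -> Q v w -> Q u w) ->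
  (forall t, a <= t <= b -> exists eta, 0 < eta /\
     forall u v, a <= u -> u <= t -> t <= v -> v <= b ->
       t - u < eta -> v - t < eta -> Q u v) ->
  Q a b.
Proof.
  intros Hab Hadd Hloc.
  assert (Ha : Q a a).
  { destruct (Hloc a) as [eta [He H]]; [lra|]. apply H; lra. }
  destruct (sup_exists (fun t => a <= t <= b /\ Q a t) b a) as [s [Hs1 Hs2]].
  - tauto.
  - split; [lra|exact Ha].
  - assert (Has : a <= s) by (apply Hs1; split; [lra|exact Ha]).
    assert (Hsb : s <= b) by (apply Hs2; tauto).
    destruct (Hloc s) as [eta [He H]]; [lra|].
    destruct (classic (exists t, a <= t <= b /\ Q a t /\ s - eta < t)) as [[t [Ht [Qt Hst]]]|Hn].
    + assert (t <= s) by (apply Hs1; tauto).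
      set (v := Rmin b (s + eta / 2)).
      assert (Hv : s <= v <= b /\ v - s < eta /\ (v = b \/ s < v)).
      { unfold v, Rmin. destruct (Rle_dec b (s + eta / 2)); lra. }
      assert (Qv : Q a v).
      { apply (Hadd a t v); try lra; try assumption. apply H; lra. }
      destruct Hv as [Hv1 [Hv2 [-> | Hv3]]]; [exact Qv|].
      assert (v <= s) by (apply Hs1; split; [lra|exact Qv]). lra.
    + assert (s <= s - eta); [|lra].
      apply Hs2. intros t [Ht Qt].
      destruct (Rle_dec t (s - eta)) as [|n]; [assumption|].
      exfalso. apply Hn. exists t. repeat split; try tauto; lra.
Qed.

Lemma Rdist_lt (a b e : R) : Rdist a b < e <-> - e < a - b < e.
Proof.
  unfold Rdist. split.
  - intros H. apply Rabs_def2 in H. lra.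
  - intros H. apply Rabs_def1; lra.
Qed.

Definition convex (J : R -> Prop) : Prop :=
  forall a b t, J a -> J b -> a <= t <= b -> J t.

Lemma unit_interval_convex : convex unit_interval.
Proof. unfold convex, unit_interval. intros; lra. Qed.

Lemma open_unit_interval_convex : convex open_unit_interval.
Proof. unfold convex, open_unit_interval. intros; lra. Qed.

Lemma segment_convex (a b : R) : convex (fun t => a <= t <= b).
Proof. unfold convex. intros; lra. Qed.

Lemma continuous_on_subset {X Y : Type} (dX : X -> X -> R) (dY : Y -> Y -> R)
  (A B : X -> Prop) (f : X -> Y) :
  subset A B -> continuous_on dX dY B f -> continuous_on dX dY A f.
Proof.
  intros HAB Hf x Hx eps He.
  destruct (Hf x (HAB x Hx) eps He) as [del [Hd H]].
  exists del. split; [assumption|]. intros y Hy. apply H. now apply HAB.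
Qed.

(** * Continuous images of an interval: the easy half of the Hahn-Mazurkiewicz theorem *)

Section ImageOfInterval.
Variable X : Type.
Variable d : X -> X -> R.
Hypothesis Hd : is_metric X d.

(** If [U] and [V] were disjoint, membership of [g t] in [U] would be locally constant in [t], hence
    constant by the local-to-global principle. *)
Lemma connected_image (J : R -> Prop) (g : R -> X) (E : X -> Prop) :
  convex J -> continuous_on Rdist d J g ->
  (forall t, J t -> E (g t)) -> (forall y, E y -> exists t, J t /\ g t = y) ->
  connected_set X d E.
Proof.
  intros HJ Hg HE1 HE2 U V [HU1 HU] [HV1 HV] Hcov [u Hu] [v Hv].
  apply NNPP. intros Hdis.
  assert (key : forall a b, J a -> J b -> a <= b -> (U (g a) <-> U (g b))).
  { intros a b Ja Jb Hab.
    apply (interval_local_to_global (fun s t => U (g s) <-> U (g t)) a b Hab).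
    - intros; tauto.
    - intros t Ht. assert (Jt : J t) by (apply (HJ a b); assumption).
      assert (L : exists eta, 0 < eta /\ forall s, J s -> Rdist t s < eta -> (U (g t) <-> U (g s))).
      { destruct (Hcov (g t) (HE1 t Jt)) as [Ut|Vt].
        - destruct (HU _ Ut) as [r [Hr H]].
          destruct (Hg t Jt r Hr) as [eta [He H']].
          exists eta. split; [assumption|]. intros s Js Hs.
          split; [|tauto]. intros _. apply H; [now apply HE1 | now apply H'].
        - destruct (HV _ Vt) as [r [Hr H]].
          destruct (Hg t Jt r Hr) as [eta [He H']].
          exists eta. split; [assumption|]. intros s Js Hs.
          assert (V (g s)) by (apply H; [now apply HE1 | now apply H']).
          split; intros HUU; exfalso; apply Hdis; [exists (g t) | exists (g s)]; tauto. }
      destruct L as [eta [He L]]. exists eta. split; [assumption|].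
      intros s w H1 H2 H3 H4 H5 H6.
      rewrite <- (L s), <- (L w); [tauto| | | |].
      + apply (HJ a b); try assumption; lra.
      + apply Rdist_lt; lra.
      + apply (HJ a b); try assumption; lra.
      + apply Rdist_lt; lra. }
  destruct (HE2 u (HU1 u Hu)) as [s [Js Es]].
  destruct (HE2 v (HV1 v Hv)) as [t [Jt Et]].
  subst u v. apply Hdis. exists (g t). split; [|assumption].
  destruct (Rle_dec s t).
  - apply (key s t); assumption || lra.
  - apply (key t s); assumption || lra.
Qed.

Variable g : R -> X.
Hypothesis Hg : continuous_on Rdist d unit_interval g.
Hypothesis Hsurj : forall y, exists t, unit_interval t /\ g t = y.

Lemma compact_image : compact_space X d.
Proof.
  intros F HF Hcov.
  assert (H : exists l, (forall U, In U l -> F U) /\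
     forall t, 0 <= t <= 1 -> exists U, In U l /\ U (g t)).
  { apply (interval_local_to_global (fun a b => exists l, (forall U, In U l -> F U) /\
       forall t, a <= t <= b -> exists U, In U l /\ U (g t)) 0 1); [lra| |].
    - intros u v w H1 H2 H3 H4 [l [Hl1 Hl2]] [m [Hm1 Hm2]].
      exists (l ++ m). split.
      + intros U HU. apply in_app_or in HU. destruct HU; auto.
      + intros t Ht. destruct (Rle_dec t v).
        * destruct (Hl2 t) as [U [HU1 HU2]]; [lra|]. exists U. split; [apply in_or_app; tauto|assumption].
        * destruct (Hm2 t) as [U [HU1 HU2]]; [lra|]. exists U. split; [apply in_or_app; tauto|assumption].
    - intros t Ht. destruct (Hcov (g t)) as [U [FU Ut]].
      destruct (HF U FU _ Ut) as [r [Hr HU]].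
      destruct (Hg t Ht r Hr) as [eta [He H]].
      exists eta. split; [assumption|]. intros u v H1 H2 H3 H4 H5 H6.
      exists (U :: nil). split.
      + intros W [<-|[]]. assumption.
      + intros s Hs. exists U. split; [left; reflexivity|].
        apply HU, H; [unfold unit_interval; lra|]. apply Rdist_lt; lra. }
  destruct H as [l [Hl1 Hl2]]. exists l. split; [assumption|].
  intros x. destruct (Hsurj x) as [t [Ht <-]]. now apply Hl2.
Qed.

Lemma connected_image_space : connected_space X d.
Proof.
  apply (connected_image unit_interval g); auto.
  exact unit_interval_convex.
Qed.

Lemma connected_star_union (x : X) (A : X -> Prop) :
  (forall y, A y -> exists B, connected_set X d B /\ B x /\ B y /\ subset B A) ->
  connected_set X d A.
Proof.
  intros HA U V [HU1 HU] [HV1 HV] Hcov [u Hu] [v Hv].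
  assert (Ax : A x).
  { destruct (HA u (HU1 u Hu)) as [B [_ [Bx [_ HB]]]]. now apply HB. }
  assert (key : forall U V, rel_open X d A U -> rel_open X d A V ->
     (forall x, A x -> U x \/ V x) -> U x -> (exists v, V v) -> exists z, U z /\ V z).
  { clear - HA. intros U V [HU1 HU] [HV1 HV] Hcov Ux [v Hv].
    destruct (HA v (HV1 v Hv)) as [B [HB [Bx [Bv HBA]]]].
    destruct (HB (fun y => B y /\ U y) (fun y => B y /\ V y)) as [z Hz].
    - split; [intros y; tauto|]. intros y [By Uy].
      destruct (HU y Uy) as [r [Hr H]]. exists r. split; [assumption|].
      intros z Bz Hz. split; [assumption|]. apply H; auto.
    - split; [intros y; tauto|]. intros y [By Vy].
      destruct (HV y Vy) as [r [Hr H]]. exists r. split; [assumption|].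
      intros z Bz Hz. split; [assumption|]. apply H; auto.
    - intros y By. destruct (Hcov y (HBA y By)); tauto.
    - exists x; tauto.
    - exists v; tauto.
    - exists z; tauto. }
  destruct (Hcov x Ax) as [Ux|Vx].
  - apply (key U V); try assumption; [split; assumption | split; assumption | exists v; assumption].
  - destruct (key V U) as [z Hz]; try assumption;
      [split; assumption | split; assumption | intros y Ay; destruct (Hcov y Ay); tauto
      | exists u; assumption | exists z; tauto].
Qed.

(** Near a parameter with value [y], the image of a short interval is the required set. Near any
    other parameter the curve keeps a positive distance from [y], so the claim holds vacuously for
    small [eta]. Finitely many such windows cover the interval. *)
Lemma small_connected_sets (y : X) (r : R) :
  0 < r -> exists eta, 0 < eta /\ forall y', d y y' < eta ->
    exists A, connected_set X d A /\ A y /\ A y' /\ (forall z, A z -> d y z < r).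
Proof.
  destruct Hd as [Hpos [H0 [Hsym Htri]]].
  intros Hr.
  assert (H : exists eta, 0 < eta /\ forall t, 0 <= t <= 1 -> d y (g t) < eta ->
    exists A, connected_set X d A /\ A y /\ A (g t) /\ (forall z, A z -> d y z < r)).
  { apply (interval_local_to_global (fun a b => exists eta, 0 < eta /\ forall t, a <= t <= b ->
      d y (g t) < eta ->
      exists A, connected_set X d A /\ A y /\ A (g t) /\ (forall z, A z -> d y z < r)) 0 1); [lra| |].
    - intros u v w H1 H2 H3 H4 [e1 [He1 K1]] [e2 [He2 K2]].
      exists (Rmin e1 e2). split; [now apply Rmin_pos|].
      intros t Ht Hdt. pose proof (Rmin_l e1 e2). pose proof (Rmin_r e1 e2).
      destruct (Rle_dec t v); [apply K1; lra | apply K2; lra].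
    - intros t Ht. destruct (classic (g t = y)) as [E|N].
      + destruct (Hg t Ht r Hr) as [eta [He H]].
        exists eta. split; [assumption|]. intros u v H1 H2 H3 H4 H5 H6.
        (* Any positive value serves: every point of this window is joined to [y], whatever its
           distance. *)
        exists 1. split; [lra|]. intros s Hs _.
        exists (fun x => exists p, u <= p <= v /\ g p = x). split; [|split; [|split]].
        * apply (connected_image (fun p => u <= p <= v) g).
          -- apply segment_convex.
          -- apply (continuous_on_subset _ _ _ unit_interval); [|exact Hg].
             intros p Hp. unfold unit_interval. lra.
          -- intros p Hp. exists p. split; [assumption|reflexivity].
          -- tauto.
        * exists t. split; [lra|assumption].
        * exists s. split; [lra|reflexivity].
        * intros z [p [Hp <-]]. rewrite <- E. apply H; [unfold unit_interval; lra|].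
          apply Rdist_lt; lra.
      + assert (Hp : 0 < d y (g t)).
        { destruct (Rle_lt_or_eq_dec 0 _ (Hpos y (g t))) as [|E]; [assumption|].
          symmetry in E. apply H0 in E. congruence. }
        destruct (Hg t Ht (d y (g t) / 2)) as [eta [He H]]; [lra|].
        exists eta. split; [assumption|]. intros u v H1 H2 H3 H4 H5 H6.
        exists (d y (g t) / 2). split; [lra|]. intros s Hs Hds. exfalso.
        assert (Hts : d (g t) (g s) < d y (g t) / 2).
        { apply H; [unfold unit_interval; lra|]. apply Rdist_lt; lra. }
        pose proof (Htri y (g s) (g t)). rewrite (Hsym (g s) (g t)) in *. lra. }
  destruct H as [eta [He H]]. exists eta. split; [assumption|].
  intros y' Hy'. destruct (Hsurj y') as [t [Ht <-]]. now apply H.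
Qed.

(** The union of all connected subsets of [U] through [x] is connected, and [small_connected_sets]
    makes it open: a point near one of its members can be attached by a small connected set. *)
Lemma locally_connected_image : locally_connected X d.
Proof.
  intros x U HU Ux.
  set (V := fun y => exists A, connected_set X d A /\ A x /\ A y /\ subset A U).
  assert (VU : subset V U).
  { intros y [A [_ [_ [Ay AU]]]]. now apply AU. }
  assert (Vconn : forall A, connected_set X d A -> A x -> subset A U -> subset A V).
  { intros A HA Ax AU y Ay. exists A. auto. }
  exists V. split; [|split; [|split]].
  - intros y Vy. destruct (HU y (VU y Vy)) as [r [Hr Hball]].
    destruct (small_connected_sets y r Hr) as [eta [He H]].
    exists eta. split; [assumption|]. intros y' Hy'.
    destruct (H y' Hy') as [B [HB [By [By' HBr]]]].
    destruct Vy as [A [HA [Ax [Ay AU]]]].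
    exists (fun z => A z \/ B z). split; [|split; [|split]]; [|tauto|tauto|].
    + apply (connected_star_union y). intros z [Az|Bz].
      * exists A. split; [assumption|split; [assumption|split; [assumption|]]]. intros w; tauto.
      * exists B. split; [assumption|split; [assumption|split; [assumption|]]]. intros w; tauto.
    + intros z [Az|Bz]; [now apply AU | apply Hball; now apply HBr].
  - destruct Hd as [_ [H0 _]].
    exists (eq x). split; [|split; [|split]]; try reflexivity.
    + intros U1 V1 [HU1 _] [HV1 _] _ [u Hu] [v Hv].
      exists x. split; [rewrite (HU1 u Hu) | rewrite (HV1 v Hv)]; assumption.
    + intros z <-. assumption.
  - exact VU.
  - apply (connected_star_union x). intros y [A [HA [Ax [Ay AU]]]].
    exists A. split; [assumption|split; [assumption|split; [assumption|]]]. now apply Vconn.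
Qed.

Lemma Peano_continuum_image : Peano_continuum X d.
Proof.
  split; [exact Hd|split; [exact compact_image|split; [exact connected_image_space|]]].
  exact locally_connected_image.
Qed.

End ImageOfInterval.

(** * Choice, loops in the line, closed sets and their gaps *)

Lemma dependent_free_choice {A B : Type} (P : A -> B -> Prop) :
  (forall a, exists b, P a b) -> exists f, forall a, P a (f a).
Proof.
  intros H.
  exists (fun a => proj1_sig (constructive_indefinite_description _ (H a))).
  intros a. exact (proj2_sig (constructive_indefinite_description _ (H a))).
Qed.

Lemma intermediate_value (f : R -> R) (a b c : R) :
  a <= b -> continuous_on Rdist Rdist (fun t => a <= t <= b) f ->
  (f a < c < f b \/ f b < c < f a) -> exists t, a <= t <= b /\ f t = c.
Proof.
  intros Hab Hf Hc. apply NNPP. intros Hn.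
  assert (K : f a < c <-> f b < c); [|lra].
  apply (interval_local_to_global (fun u v => f u < c <-> f v < c) a b Hab); [tauto|].
  intros t Ht.
  assert (Htc : f t <> c) by (intros E; apply Hn; exists t; tauto).
  destruct (Hf t Ht (Rabs (f t - c))) as [eta [He H]]; [apply Rabs_pos_lt; lra|].
  exists eta. split; [assumption|]. intros u v H1 H2 H3 H4 H5 H6.
  assert (Hu := H u ltac:(lra) ltac:(apply Rdist_lt; lra)).
  assert (Hv := H v ltac:(lra) ltac:(apply Rdist_lt; lra)).
  apply Rdist_lt in Hu, Hv.
  unfold Rabs in *. destruct (Rcase_abs (f t - c)); lra.
Qed.

(** The value halfway between [f 0] and [f (1/2)] is attained on both halves of the loop. *)
Lemma no_injective_loop_in_R (f : R -> R) :
  continuous_on Rdist Rdist unit_interval f -> f 0 = f 1 ->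
  (forall s t, 0 <= s < 1 -> 0 <= t < 1 -> f s = f t -> s = t) -> False.
Proof.
  intros Hf H01 Hinj.
  assert (Hm : f (1/2) <> f 0).
  { intros E. assert (1/2 = 0); [apply Hinj; lra|lra]. }
  set (c := (f 0 + f (1/2)) / 2).
  destruct (intermediate_value f 0 (1/2) c) as [s [Hs Es]]; [lra| |unfold c; lra|].
  { apply (continuous_on_subset _ _ _ unit_interval); [|exact Hf].
    intros t Ht. unfold unit_interval. lra. }
  destruct (intermediate_value f (1/2) 1 c) as [t [Ht Et]]; [lra| |unfold c; lra|].
  { apply (continuous_on_subset _ _ _ unit_interval); [|exact Hf].
    intros t Ht. unfold unit_interval. lra. }
  assert (t <> 1) by (intros ->; unfold c in Et; lra).
  assert (s = t) by (apply Hinj; lra).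
  assert (s = 1/2) by lra.
  rewrite H1 in Es. unfold c in Es. lra.
Qed.

Definition is_closed_in_R (C : R -> Prop) : Prop :=
  forall t, ~ C t -> exists r, 0 < r /\ forall u, Rabs (t - u) < r -> ~ C u.

(** [D t] is the infimum of |t - c| over [C]; the gluing relies on these four properties only. *)
Lemma distance_to_closed_set (C : R -> Prop) (c0 : R) :
  C c0 -> is_closed_in_R C ->
  exists D : R -> R, (forall t, 0 <= D t) /\
    (forall s t, D s <= D t + Rabs (s - t)) /\
    (forall t, C t -> D t = 0) /\ (forall t, ~ C t -> 0 < D t).
Proof.
  intros HC0 Hcl.
  destruct (dependent_free_choice (fun t D =>
     (forall c, C c -> D <= Rabs (t - c)) /\
     (forall b, (forall c, C c -> b <= Rabs (t - c)) -> b <= D))) as [D HD].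
  { intros t.
    destruct (inf_exists (fun x => exists c, C c /\ x = Rabs (t - c)) 0 (Rabs (t - c0)))
      as [s [Hs1 Hs2]].
    - intros x [c [_ ->]]. apply Rabs_pos.
    - exists c0. auto.
    - exists s. split.
      + intros c Hc. apply Hs1. exists c. auto.
      + intros b Hb. apply Hs2. intros x [c [Hc ->]]. auto. }
  assert (Hpos : forall t, 0 <= D t).
  { intros t. apply HD. intros c _. apply Rabs_pos. }
  exists D. split; [exact Hpos|split; [|split]].
  - intros s t. assert (D s - Rabs (s - t) <= D t); [|lra].
    apply HD. intros c Hc. destruct (HD s) as [H _]. specialize (H c Hc).
    replace (s - c) with ((s - t) + (t - c)) in H by ring.
    pose proof (Rabs_triang (s - t) (t - c)). lra.
  - intros t Ht. apply Rle_antisym; [|apply Hpos].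
    destruct (HD t) as [H _]. specialize (H t Ht).
    replace (t - t) with 0 in H by ring. now rewrite Rabs_R0 in H.
  - intros t Ht. destruct (Hcl t Ht) as [r [Hr H]].
    apply Rlt_le_trans with r; [assumption|]. apply HD.
    intros c Hc. destruct (Rle_dec r (Rabs (t - c))) as [|n]; [assumption|].
    exfalso. apply (H c); [lra|assumption].
Qed.

Lemma complementary_gap (C : R -> Prop) (s : R) :
  is_closed_in_R C -> C 0 -> C 1 -> 0 <= s <= 1 -> ~ C s ->
  exists a b, 0 <= a /\ a < s /\ s < b /\ b <= 1 /\ C a /\ C b /\ forall t, a < t < b -> ~ C t.
Proof.
  intros Hcl C0 C1 Hs NC.
  destruct (sup_exists (fun t => C t /\ t <= s) s 0) as [a [Ha1 Ha2]]; [tauto|split; [assumption|lra]|].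
  destruct (inf_exists (fun t => C t /\ s <= t) s 1) as [b [Hb1 Hb2]]; [tauto|split; [assumption|lra]|].
  assert (Has : a <= s) by (apply Ha2; tauto).
  assert (Hsb : s <= b) by (apply Hb2; tauto).
  assert (Ca : C a).
  { apply NNPP. intros Na. destruct (Hcl a Na) as [r [Hr H]].
    assert (a <= a - r); [|lra]. apply Ha2. intros t [Ct Hts].
    destruct (Rle_dec t (a - r)) as [|n]; [assumption|]. exfalso.
    assert (t <= a) by (apply Ha1; tauto).
    apply (H t); [apply Rabs_def1; lra|assumption]. }
  assert (Cb : C b).
  { apply NNPP. intros Nb. destruct (Hcl b Nb) as [r [Hr H]].
    assert (b + r <= b); [|lra]. apply Hb2. intros t [Ct Hts].
    destruct (Rle_dec (b + r) t) as [|n]; [assumption|]. exfalso.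
    assert (b <= t) by (apply Hb1; tauto).
    apply (H t); [apply Rabs_def1; lra|assumption]. }
  assert (a <> s) by (intros ->; tauto).
  assert (b <> s) by (intros ->; tauto).
  exists a, b. repeat split; try assumption; try lra.
  - apply Ha1; split; [assumption|lra].
  - apply Hb1; split; [assumption|lra].
  - intros t Ht Ct. destruct (Rle_dec t s).
    + assert (t <= a) by (apply Ha1; tauto). lra.
    + assert (b <= t) by (apply Hb1; split; [assumption|lra]). lra.
Qed.

(** * The supremum metric on function spaces *)

Definition is_sup_dist {I : Type} (F G : I -> R) (s : R) : Prop :=
  (forall i, Rabs (F i - G i) <= s) /\
  (forall b, (forall i, Rabs (F i - G i) <= b) -> s <= b).

(** Total thanks to [epsilon], but meaningful only for functions with bounded difference. *)
Definition sup_dist {I : Type} (F G : I -> R) : R :=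
  epsilon (inhabits 0) (is_sup_dist F G).

Lemma sup_dist_spec {I : Type} (i0 : I) (F G : I -> R) (B : R) :
  (forall i, Rabs (F i - G i) <= B) -> is_sup_dist F G (sup_dist F G).
Proof.
  intros HB. unfold sup_dist. apply epsilon_spec.
  destruct (sup_exists (fun x => exists i, x = Rabs (F i - G i)) B (Rabs (F i0 - G i0)))
    as [s [Hs1 Hs2]].
  - intros x [i ->]. apply HB.
  - exists i0. reflexivity.
  - exists s. split.
    + intros i. apply Hs1. exists i. reflexivity.
    + intros b Hb. apply Hs2. intros x [i ->]. apply Hb.
Qed.

(** Only differences of members have to be bounded. The members may be unbounded, as happens below
    for coordinates indexed by all of R. *)
Lemma sup_dist_metric {I : Type} (i0 : I) (S : (I -> R) -> Prop) :
  (forall F G, S F -> S G -> exists B, forall i, Rabs (F i - G i) <= B) ->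
  is_metric {F | S F} (fun p q => sup_dist (proj1_sig p) (proj1_sig q)).
Proof.
  intros HB.
  assert (K : forall p q : {F | S F},
    is_sup_dist (proj1_sig p) (proj1_sig q) (sup_dist (proj1_sig p) (proj1_sig q))).
  { intros [F HF] [G HG]. simpl. destruct (HB F G HF HG) as [B H].
    now apply (sup_dist_spec i0 F G B). }
  split; [|split; [|split]].
  - intros p q. apply Rle_trans with (Rabs (proj1_sig p i0 - proj1_sig q i0)); [apply Rabs_pos|].
    apply K.
  - intros p q. split.
    + intros E. destruct (K p q) as [H _]. rewrite E in H.
      apply eq_sig_hprop; [intros; apply proof_irrelevance|].
      apply functional_extensionality. intros i. apply Rabs_eq0_of_eps.
      intros e He. specialize (H i). lra.
    + intros <-. apply Rle_antisym.
      * apply K. intros i. replace (proj1_sig p i - proj1_sig p i) with 0 by ring.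
        rewrite Rabs_R0. lra.
      * apply Rle_trans with (Rabs (proj1_sig p i0 - proj1_sig p i0)); [apply Rabs_pos|].
        apply K.
  - assert (L : forall p q : {F | S F},
      sup_dist (proj1_sig p) (proj1_sig q) <= sup_dist (proj1_sig q) (proj1_sig p)).
    { intros p q. apply K. intros i. rewrite Rabs_minus_sym. apply K. }
    intros p q. apply Rle_antisym; apply L.
  - intros p q r. apply K. intros i.
    replace (proj1_sig p i - proj1_sig r i) with
      ((proj1_sig p i - proj1_sig q i) + (proj1_sig q i - proj1_sig r i)) by ring.
    destruct (K p q) as [H1 _]. destruct (K q r) as [H2 _].
    specialize (H1 i). specialize (H2 i).
    pose proof (Rabs_triang (proj1_sig p i - proj1_sig q i) (proj1_sig q i - proj1_sig r i)). lra.
Qed.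

(** * Gluing an interval to a space along a closed set *)

Section Gluing.
Variable Z : Type.
Variable dZ : Z -> Z -> R.
Hypothesis HdZ : is_metric Z dZ.
Variable C : R -> Prop.
Hypothesis C_unit : forall t, C t -> unit_interval t.
Hypothesis C0 : C 0.
Hypothesis C1 : C 1.
Hypothesis C_closed : is_closed_in_R C.
Variable Phi : R -> Z -> R.
(** The ends [a] and [b] are not ordered, since the affine maps that produce them may reverse
    orientation; hence the gap is written as a segment from [a] to [b]. *)
Hypothesis loop_gaps_dense : forall t eta, C t -> 0 < eta ->
  exists a b, a <> b /\ Rabs (a - t) < eta /\ Rabs (b - t) < eta /\ C a /\ C b /\
    (forall tau, 0 < tau < 1 -> ~ C (a + tau * (b - a))) /\ (forall z, Phi a z = Phi b z).
Hypothesis Phi_on_C : forall t, C t -> exists p, forall z, Phi t z = dZ p z.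
Hypothesis Phi_onto : forall p, exists t, C t /\ forall z, Phi t z = dZ p z.
Hypothesis Phi_continuous : forall eps, 0 < eps -> exists eta, 0 < eta /\
  forall s t, unit_interval s -> unit_interval t -> Rabs (s - t) < eta ->
    forall z, Rabs (Phi s z - Phi t z) <= eps.
Hypothesis Phi_bounded : exists B, forall s t z,
  unit_interval s -> unit_interval t -> Rabs (Phi s z - Phi t z) <= B.

Variable D : R -> R.
Hypothesis D_pos : forall t, 0 <= D t.
Hypothesis D_lip : forall s t, D s <= D t + Rabs (s - t).
Hypothesis D_C : forall t, C t -> D t = 0.
Hypothesis D_nC : forall t, ~ C t -> 0 < D t.

(* The pseudometric of [0,1] with C collapsed to a point. *)
Definition collapsed_dist (s t : R) : R := Rmin (Rabs (s - t)) (D s + D t).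

(** [Phi] need not separate the points of a gap. The [inr] coordinates do, and as they coincide for
    all parameters in [C], they preserve the identifications that [Phi] makes there. *)
Definition embedding (t : R) (i : Z + R) : R :=
  match i with inl z => Phi t z | inr c => collapsed_dist t c end.

Definition in_curve (F : Z + R -> R) : Prop :=
  exists t, unit_interval t /\ F = embedding t.

(** Points are functions rather than parameters, so the quotient needs no equivalence classes:
    parameters are identified exactly when all their coordinates agree. *)
Definition glued : Type := {F | in_curve F}.

Definition glued_dist (p q : glued) : R := sup_dist (proj1_sig p) (proj1_sig q).

(** Retraction onto [0,1], needed because [curve] is a total function into a subtype. *)
Definition clamp (t : R) : R := Rmax 0 (Rmin t 1).

Lemma clamp_unit (t : R) : unit_interval (clamp t).
Proof.
  unfold unit_interval, clamp, Rmax, Rmin.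
  destruct (Rle_dec t 1); destruct (Rle_dec 0 _); lra.
Qed.

Lemma clamp_id (t : R) : unit_interval t -> clamp t = t.
Proof.
  unfold unit_interval, clamp, Rmax, Rmin. intros H.
  destruct (Rle_dec t 1); destruct (Rle_dec 0 _); lra.
Qed.

Definition curve (t : R) : glued :=
  exist in_curve (embedding (clamp t)) (ex_intro _ (clamp t) (conj (clamp_unit t) eq_refl)).

Lemma curve_val (t : R) : unit_interval t -> proj1_sig (curve t) = embedding t.
Proof. intros H. simpl. now rewrite clamp_id. Qed.

Lemma curve_surjective (p : glued) : exists t, unit_interval t /\ curve t = p.
Proof.
  destruct p as [F [t [Ht E]]]. exists t. split; [assumption|].
  apply eq_sig_hprop; [intros; apply proof_irrelevance|].
  rewrite curve_val; auto.
Qed.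

Lemma collapsed_dist_lip (s t c : R) :
  Rabs (collapsed_dist s c - collapsed_dist t c) <= Rabs (s - t).
Proof.
  assert (L : forall s t, collapsed_dist s c <= collapsed_dist t c + Rabs (s - t)).
  { clear s t. intros s t. unfold collapsed_dist.
    pose proof (D_lip s t).
    assert (Rabs (s - c) <= Rabs (t - c) + Rabs (s - t)).
    { replace (s - c) with ((s - t) + (t - c)) by ring.
      pose proof (Rabs_triang (s - t) (t - c)). lra. }
    unfold Rmin. destruct (Rle_dec (Rabs (s - c)) _); destruct (Rle_dec (Rabs (t - c)) _); lra. }
  apply Rabs_le. pose proof (L s t). pose proof (L t s).
  rewrite (Rabs_minus_sym t s) in *. lra.
Qed.

Lemma collapsed_dist_C (t c : R) : C t -> collapsed_dist t c = D c.
Proof.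
  intros Ct. unfold collapsed_dist. rewrite (D_C t Ct).
  pose proof (D_lip c t). rewrite (D_C t Ct), (Rabs_minus_sym c t) in H.
  rewrite Rmin_right; lra.
Qed.

Lemma embedding_bounded (F G : Z + R -> R) :
  in_curve F -> in_curve G -> exists B, forall i, Rabs (F i - G i) <= B.
Proof.
  intros [s [Hs ->]] [t [Ht ->]]. destruct Phi_bounded as [B HB].
  exists (Rmax B (Rabs (s - t))). intros [z|c]; simpl.
  - eapply Rle_trans; [now apply HB|]. apply Rmax_l.
  - eapply Rle_trans; [apply collapsed_dist_lip|]. apply Rmax_r.
Qed.

Lemma glued_metric : is_metric glued glued_dist.
Proof. apply (sup_dist_metric (inr 0)). exact embedding_bounded. Qed.

Lemma glued_dist_spec (s t : R) : unit_interval s -> unit_interval t ->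
  is_sup_dist (embedding s) (embedding t) (glued_dist (curve s) (curve t)).
Proof.
  intros Hs Ht. unfold glued_dist. rewrite !curve_val by assumption.
  destruct (embedding_bounded (embedding s) (embedding t)) as [B HB];
    [exists s; auto | exists t; auto |].
  now apply (sup_dist_spec (inr 0) _ _ B).
Qed.

Lemma curve_continuous : continuous_on Rdist glued_dist unit_interval curve.
Proof.
  intros s Hs eps He.
  destruct (Phi_continuous (eps / 2)) as [eta [Heta H]]; [lra|].
  exists (Rmin eta (eps / 2)). split; [apply Rmin_pos; lra|].
  intros t Ht Hst. unfold Rdist in Hst.
  pose proof (Rmin_l eta (eps / 2)). pose proof (Rmin_r eta (eps / 2)).
  apply Rle_lt_trans with (eps / 2); [|lra].
  apply (glued_dist_spec s t Hs Ht). intros [z|c]; simpl.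
  - apply H; try assumption. lra.
  - eapply Rle_trans; [apply collapsed_dist_lip|]. lra.
Qed.

Lemma collapsed_dist_le (s t : R) : unit_interval s -> unit_interval t ->
  collapsed_dist s t <= glued_dist (curve s) (curve t).
Proof.
  intros Hs Ht. destruct (glued_dist_spec s t Hs Ht) as [H _].
  (* At the index [t] itself the second function vanishes. *)
  specialize (H (inr t)). simpl in H.
  replace (collapsed_dist t t) with 0 in H.
  - pose proof (Rle_abs (collapsed_dist s t - 0)). lra.
  - unfold collapsed_dist. replace (t - t) with 0 by ring. rewrite Rabs_R0.
    pose proof (D_pos t). rewrite Rmin_left; lra.
Qed.

(** If the minimum in [collapsed_dist s t] were [D s + D t], it would be at least [D s]. This
    estimate yields injectivity off [C], openness of the gap images and continuity of the inverse on
    gaps. *)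
Lemma curve_locally_expanding (s t : R) : unit_interval s -> unit_interval t ->
  glued_dist (curve s) (curve t) < D s ->
  Rabs (s - t) <= glued_dist (curve s) (curve t).
Proof.
  intros Hs Ht H. pose proof (collapsed_dist_le s t Hs Ht) as K.
  unfold collapsed_dist, Rmin in K. pose proof (D_pos t).
  destruct (Rle_dec (Rabs (s - t)) (D s + D t)); lra.
Qed.

Lemma glued_dist_refl (p : glued) : glued_dist p p = 0.
Proof. destruct glued_metric as [_ [H _]]. now apply H. Qed.

Lemma curve_injective_off_C (s t : R) : unit_interval s -> unit_interval t -> ~ C s ->
  curve s = curve t -> s = t.
Proof.
  intros Hs Ht NC E. pose proof (D_nC s NC).
  pose proof (curve_locally_expanding s t Hs Ht) as H1.
  rewrite <- E, glued_dist_refl in H1. specialize (H1 H).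
  apply Rabs_eq0_of_eps. intros; lra.
Qed.

Lemma Phi_section_exists : exists tau : Z -> R, forall p, C (tau p) /\ forall z, Phi (tau p) z = dZ p z.
Proof. exact (dependent_free_choice _ Phi_onto). Qed.

Variable tau : Z -> R.
Hypothesis tau_spec : forall p, C (tau p) /\ forall z, Phi (tau p) z = dZ p z.

(** [tau] is an arbitrary, possibly discontinuous section; by [curve_ground] the resulting point
    does not depend on it. *)
Definition ground (p : Z) : glued := curve (tau p).

Lemma curve_eq_on_C (s t : R) : C s -> C t -> (forall z, Phi s z = Phi t z) -> curve s = curve t.
Proof.
  intros Cs Ct H. apply eq_sig_hprop; [intros; apply proof_irrelevance|].
  rewrite !curve_val by now apply C_unit.
  apply functional_extensionality. intros [z|c]; simpl; [apply H|].
  now rewrite !collapsed_dist_C.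
Qed.

Lemma curve_ground (t : R) (p : Z) : C t -> (forall z, Phi t z = dZ p z) -> curve t = ground p.
Proof.
  intros Ct H. destruct (tau_spec p) as [Cp Hp]. apply curve_eq_on_C; try assumption.
  intros z. now rewrite H, Hp.
Qed.

Lemma curve_on_C (t : R) : C t -> exists p, curve t = ground p.
Proof.
  intros Ct. destruct (Phi_on_C t Ct) as [p Hp]. exists p. now apply curve_ground.
Qed.

Lemma ground_isometry (p q : Z) : glued_dist (ground p) (ground q) = dZ p q.
Proof.
  destruct HdZ as [Hpos [H0 [Hsym Htri]]].
  destruct (tau_spec p) as [Cp Hp]. destruct (tau_spec q) as [Cq Hq].
  destruct (glued_dist_spec (tau p) (tau q)) as [Ha Hb]; try now apply C_unit.
  unfold ground. apply Rle_antisym.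
  - apply Hb. intros [z|c]; simpl.
    + rewrite Hp, Hq. apply Rabs_le.
      pose proof (Htri p q z). pose proof (Htri q p z). rewrite (Hsym q p) in *. lra.
    + rewrite !collapsed_dist_C by assumption. replace (D c - D c) with 0 by ring.
      rewrite Rabs_R0. apply Hpos.
  (* The Kuratowski coordinate at [q] already attains [dZ p q]. *)
  - specialize (Ha (inl q)). simpl in Ha. rewrite Hp, Hq in Ha.
    replace (dZ q q) with 0 in Ha by (symmetry; now apply H0).
    pose proof (Rle_abs (dZ p q - 0)). lra.
Qed.

(** Pulling a loop gap inside [E] back along the parametrization [h] gives a loop in R that is
    injective except for its ends. Stated for every open arc, not only for edges, because maximality
    of the gaps compares them with arbitrary larger arcs. *)
Lemma open_arc_avoids_C (E : glued -> Prop) (t : R) :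
  open_arc glued glued_dist E -> C t -> ~ E (curve t).
Proof.
  intros [HE [h [h1 [h2 [h3 [h4 h5]]]]]] Ct Et.
  destruct (HE _ Et) as [r [Hr Hball]].
  assert (Ut : unit_interval t) by now apply C_unit.
  destruct (curve_continuous t Ut r Hr) as [eta [Heta Hc]].
  destruct (loop_gaps_dense t eta Ct Heta) as [a [b [Hab [Ha [Hb [Ca [Cb [Hgap HPhi]]]]]]]].
  assert (Ua := C_unit a Ca). assert (Ub := C_unit b Cb).
  set (c := fun s : R => a + s * (b - a)).
  assert (Uc : forall s, unit_interval s -> unit_interval (c s)).
  { intros s Hs. unfold unit_interval, c in *. nra. }
  assert (Nc : forall s, unit_interval s -> Rabs (c s - t) < eta).
  { intros s Hs. unfold unit_interval, c in *.
    apply Rabs_def2 in Ha, Hb. apply Rabs_def1; nra. }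
  destruct (dependent_free_choice (fun s u => unit_interval s ->
      open_unit_interval u /\ h u = curve (c s))) as [f Hf].
  { intros s. destruct (classic (unit_interval s)) as [Us|N]; [|exists 0; tauto].
    destruct (h2 (curve (c s))) as [u [Hu Eu]].
    - apply Hball, Hc; [now apply Uc|]. unfold Rdist. rewrite Rabs_minus_sym. now apply Nc.
    - exists u. auto. }
  apply (no_injective_loop_in_R f).
  - intros s Us eps He. destruct (Hf s Us) as [Os Es].
    destruct (h5 (f s) Os eps He) as [del [Hdel H]].
    destruct (curve_continuous (c s) (Uc s Us) del Hdel) as [del' [Hdel' H']].
    assert (Hba : 0 < Rabs (b - a)) by (apply Rabs_pos_lt; lra).
    exists (del' / Rabs (b - a)). split; [now apply Rdiv_lt_0_compat|].
    intros s' Us' Hs'. destruct (Hf s' Us') as [Os' Es'].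
    apply H; [assumption|]. rewrite Es, Es'. apply H'; [now apply Uc|].
    unfold Rdist, c in *.
    replace (a + s * (b - a) - (a + s' * (b - a))) with ((s - s') * (b - a)) by ring.
    rewrite Rabs_mult. now apply Rmult_lt_reg_r with (/ Rabs (b - a));
      [apply Rinv_0_lt_compat | rewrite Rmult_assoc, Rinv_r, Rmult_1_r; [|lra]].
  - assert (U0 : unit_interval 0) by (unfold unit_interval; lra).
    assert (U1 : unit_interval 1) by (unfold unit_interval; lra).
    destruct (Hf 0 U0) as [O0 E0]. destruct (Hf 1 U1) as [O1 E1].
    apply h3; try assumption. rewrite E0, E1.
    replace (c 0) with a by (unfold c; ring). replace (c 1) with b by (unfold c; ring).
    now apply curve_eq_on_C.
  - assert (K : forall s s', 0 < s < 1 -> 0 <= s' < 1 -> f s = f s' -> s = s').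
    { intros s s' Hs Hs' Efs.
      destruct (Hf s) as [O0 E0]; [unfold unit_interval; lra|].
      destruct (Hf s') as [O1 E1]; [unfold unit_interval; lra|].
      assert (Ecs : c s = c s').
      { apply curve_injective_off_C.
        - apply Uc. unfold unit_interval; lra.
        - apply Uc. unfold unit_interval; lra.
        - now apply Hgap.
        - now rewrite <- E0, <- E1, Efs. }
      unfold c in Ecs. apply Rmult_eq_reg_r with (b - a); lra. }
    intros s s' Hs Hs' Efs.
    destruct (Req_dec s 0) as [->|]; [|apply K; lra].
    destruct (Req_dec s' 0) as [->|]; [reflexivity|]. symmetry. apply K; lra.
Qed.

Definition gap_image (a b : R) (p : glued) : Prop := exists s, a < s < b /\ p = curve s.

(** [D s] is at most the distance from [s] to either end, so parameters closer than [D s] stay in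
    the gap. *)
Lemma gap_ball (a b s : R) (p : glued) :
  unit_interval a -> unit_interval b -> C a -> C b -> a < s < b ->
  glued_dist (curve s) p < D s -> gap_image a b p.
Proof.
  unfold unit_interval. intros Ua Ub Ca Cb Hs H. destruct (curve_surjective p) as [t [Ut <-]].
  assert (Us : unit_interval s) by (unfold unit_interval; lra).
  pose proof (curve_locally_expanding s t Us Ut H) as K.
  exists t. split; [|reflexivity].
  pose proof (D_lip s a) as La. pose proof (D_lip s b) as Lb.
  rewrite (D_C a Ca) in La. rewrite (D_C b Cb) in Lb.
  rewrite Rabs_right in La by lra. rewrite Rabs_left in Lb by lra.
  assert (Rabs (s - t) < D s) as K' by lra. apply Rabs_def2 in K'. lra.
Qed.

Lemma gap_open_arc (a b : R) :
  unit_interval a -> unit_interval b -> C a -> C b -> a < b -> (forall t, a < t < b -> ~ C t) ->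
  open_arc glued glued_dist (gap_image a b).
Proof.
  intros Ua Ub Ca Cb Hab Hgap. split.
  - intros p [s [Hs ->]]. exists (D s). split; [apply D_nC; auto|].
    intros q. now apply gap_ball.
  - unfold unit_interval in Ua, Ub.
    assert (Hc : forall s, open_unit_interval s -> a < a + s * (b - a) < b).
    { unfold open_unit_interval. intros s Hs. nra. }
    assert (Uc : forall s, open_unit_interval s -> unit_interval (a + s * (b - a))).
    { intros s Hs. specialize (Hc s Hs). unfold unit_interval. lra. }
    exists (fun s => curve (a + s * (b - a))). split; [|split; [|split; [|split]]].
    + intros s Hs. exists (a + s * (b - a)). auto.
    + intros p [s [Hs ->]]. exists ((s - a) / (b - a)). split.
      * unfold open_unit_interval. split.
        -- apply Rdiv_lt_0_compat; lra.
        -- apply Rmult_lt_reg_r with (b - a); [lra|]. unfold Rdiv.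
           rewrite Rmult_assoc, Rinv_l; lra.
      * f_equal. field. lra.
    + intros s s' Hs Hs' E. apply curve_injective_off_C in E; auto.
      apply Rmult_eq_reg_r with (b - a); lra.
    + intros s Hs eps He.
      destruct (curve_continuous _ (Uc s Hs) eps He) as [del [Hdel H]].
      exists del. split; [assumption|]. intros s' Hs' Hd. apply H; [now apply Uc|].
      apply Rdist_lt. apply Rdist_lt in Hd. nra.
    + intros s Hs eps He. set (t := a + s * (b - a)).
      assert (Dt : 0 < D t) by (apply D_nC; unfold t; auto).
      (* The first bound makes [curve_locally_expanding] applicable, the second undoes the affine
         rescaling. *)
      exists (Rmin (D t) (eps * (b - a))). split.
      { apply Rmin_pos; [assumption|]. apply Rmult_lt_0_compat; lra. }
      intros s' Hs' Hd. pose proof (Rmin_l (D t) (eps * (b - a))).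
      pose proof (Rmin_r (D t) (eps * (b - a))).
      assert (K := curve_locally_expanding t _ (Uc s Hs) (Uc s' Hs') ltac:(lra)).
      assert (K' : Rabs (t - (a + s' * (b - a))) < eps * (b - a)) by lra.
      unfold t in K'. apply Rabs_def2 in K'. apply Rdist_lt. nra.
Qed.

(** A larger open arc [E] is connected and avoids the image of [C]. The rest of [E] therefore lies
    in other gap images, which are open, so the given gap is both open and closed in [E]. *)
Lemma gap_free_arc (a b : R) :
  unit_interval a -> unit_interval b -> C a -> C b -> a < b -> (forall t, a < t < b -> ~ C t) ->
  free_arc glued glued_dist (gap_image a b).
Proof.
  intros Ua Ub Ca Cb Hab Hgap. split; [now apply gap_open_arc|].
  intros E HE Hsub p Ep. apply NNPP. intros Np.
  assert (HE' := HE). destruct HE' as [HO [h [h1 [h2 [_ [h4 _]]]]]].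
  assert (Hconn : connected_set glued glued_dist E).
  { apply (connected_image glued glued_dist open_unit_interval h); try assumption.
    exact open_unit_interval_convex. }
  destruct (Hconn (gap_image a b) (fun q => E q /\ ~ gap_image a b q)) as [q [Hq1 [_ Hq2]]].
  - split; [assumption|]. intros q [s [Hs ->]]. exists (D s). split; [apply D_nC; auto|].
    intros q' _. now apply gap_ball.
  - split; [intros q; tauto|]. intros q [Eq Nq].
    destruct (curve_surjective q) as [s [Us <-]].
    assert (NCs : ~ C s) by (intros Cs; now apply (open_arc_avoids_C E s)).
    exists (D s). split; [now apply D_nC|]. intros q' Eq' Hd. split; [assumption|].
    intros [u [Hu ->]]. apply Nq.
    destruct (complementary_gap C s) as [a' [b' [H1 [H2 [H3 [H4 [Ca' [Cb' Hg]]]]]]]]; auto.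
    destruct (gap_ball a' b' s (curve u)) as [u' [Hu' E']]; auto;
      try (unfold unit_interval; lra).
    assert (u = u').
    { apply curve_injective_off_C; auto; unfold unit_interval in *; lra. }
    subst u'. exists s. split; [|reflexivity].
    (* The two gaps share [u] and neither contains an end of the other, so they coincide. *)
    assert (~ a' < a < b') by (intros K; now apply (Hg a K)).
    assert (~ a' < b < b') by (intros K; now apply (Hg b K)).
    assert (~ a < a' < b) by (intros K; now apply (Hgap a' K)).
    assert (~ a < b' < b) by (intros K; now apply (Hgap b' K)). lra.
  - intros q Eq. destruct (classic (gap_image a b q)); tauto.
  - exists (curve ((a + b) / 2)). exists ((a + b) / 2). split; [lra|reflexivity].
  - exists p. tauto.
  - contradiction.
Qed.

Lemma curve_in_edge (s : R) : unit_interval s -> ~ C s -> edge_union glued glued_dist (curve s).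
Proof.
  intros Us NC.
  destruct (complementary_gap C s) as [a [b [H1 [H2 [H3 [H4 [Ca [Cb Hg]]]]]]]]; auto.
  exists (gap_image a b). split.
  - apply gap_free_arc; auto; unfold unit_interval; lra.
  - exists s. split; [lra|reflexivity].
Qed.

Lemma Gr_glued (p : glued) : Gr glued glued_dist p <-> exists z, p = ground z.
Proof.
  split.
  - intros H. destruct (curve_surjective p) as [s [Us <-]].
    apply curve_on_C. apply NNPP. intros NC. apply H. now apply curve_in_edge.
  - intros [z ->] [E [[HE _] Ez]]. apply (open_arc_avoids_C E (tau z)); try assumption.
    apply tau_spec.
Qed.

(** Nowhere density of [C] follows from density of the loop gaps: take the midpoint of a nearby
    one. *)
Lemma gap_point_near (t r : R) : unit_interval t -> 0 < r ->
  exists s, unit_interval s /\ ~ C s /\ Rabs (t - s) < r.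
Proof.
  intros Ut Hr. destruct (classic (C t)) as [Ct|NC].
  - destruct (loop_gaps_dense t r Ct Hr) as [a [b [Hab [Ha [Hb [Ca [Cb [Hg _]]]]]]]].
    exists (a + (1/2) * (b - a)). split; [|split].
    + apply C_unit in Ca, Cb. unfold unit_interval in *. lra.
    + apply Hg. lra.
    + apply Rabs_def2 in Ha, Hb. apply Rabs_def1; lra.
  - exists t. split; [assumption|split; [assumption|]].
    replace (t - t) with 0 by ring. now rewrite Rabs_R0.
Qed.

Lemma glued_Peano_graph : Peano_graph glued glued_dist.
Proof.
  split.
  - apply (Peano_continuum_image _ _ glued_metric curve curve_continuous curve_surjective).
  - intros p r Hr. destruct (curve_surjective p) as [t [Ut <-]].
    destruct (curve_continuous t Ut r Hr) as [del [Hdel H]].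
    destruct (gap_point_near t del Ut Hdel) as [s [Us [NC Hs]]].
    exists (curve s). split; [now apply curve_in_edge | now apply H].
Qed.

Lemma ground_homeo : homeo_sets dZ glued_dist (fun _ => True) (Gr glued glued_dist) ground.
Proof.
  split; [|split; [|split; [|split]]].
  - intros z _. apply Gr_glued. exists z. reflexivity.
  - intros p Hp. apply Gr_glued in Hp. destruct Hp as [z ->]. exists z. auto.
  - intros z z' _ _ E. destruct HdZ as [_ [H0 _]]. apply H0.
    rewrite <- ground_isometry, E. apply glued_dist_refl.
  - intros z _ eps He. exists eps. split; [assumption|]. intros z' _. now rewrite ground_isometry.
  - intros z _ eps He. exists eps. split; [assumption|]. intros z' _. now rewrite ground_isometry.
Qed.

Lemma curve_strongly_irreducible : strongly_irreducible glued glued_dist Rdist unit_interval curve.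
Proof.
  split; [exact curve_continuous|split; [exact curve_surjective|]].
  intros A [HA1 HA2] [t [Ut Nt]].
  assert (Hr : exists r, 0 < r /\ forall u, A u -> r <= Rdist t u).
  { apply NNPP. intros N. apply Nt. apply HA2; [assumption|]. intros r Hr.
    apply NNPP. intros N'. apply N. exists r. split; [assumption|]. intros u Au.
    destruct (Rle_dec r (Rdist t u)) as [|n]; [assumption|]. exfalso. apply N'.
    exists u. split; [assumption|lra]. }
  destruct Hr as [r [Hr Hfar]].
  destruct (gap_point_near t r Ut Hr) as [s [Us [NC Hs]]].
  exists (curve s). intros u Au E.
  assert (s = u) by (apply curve_injective_off_C; auto).
  subst u. specialize (Hfar s Au). unfold Rdist in Hfar. lra.
Qed.

End Gluing.

Theorem gluing (Z : Type) (dZ : Z -> Z -> R) (C : R -> Prop) (Phi : R -> Z -> R) :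
  is_metric Z dZ ->
  (forall t, C t -> unit_interval t) -> C 0 -> C 1 -> is_closed_in_R C ->
  (forall t eta, C t -> 0 < eta ->
     exists a b, a <> b /\ Rabs (a - t) < eta /\ Rabs (b - t) < eta /\ C a /\ C b /\
       (forall tau, 0 < tau < 1 -> ~ C (a + tau * (b - a))) /\ (forall z, Phi a z = Phi b z)) ->
  (forall t, C t -> exists p, forall z, Phi t z = dZ p z) ->
  (forall p, exists t, C t /\ forall z, Phi t z = dZ p z) ->
  (forall eps, 0 < eps -> exists eta, 0 < eta /\
     forall s t, unit_interval s -> unit_interval t -> Rabs (s - t) < eta ->
       forall z, Rabs (Phi s z - Phi t z) <= eps) ->
  (exists B, forall s t z, unit_interval s -> unit_interval t -> Rabs (Phi s z - Phi t z) <= B) ->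
  exists (X : Type) (dX : X -> X -> R) (e : Z -> X) (g : R -> X),
    Peano_graph X dX /\ homeo_sets dZ dX (fun _ => True) (Gr X dX) e /\
    strongly_irreducible X dX Rdist unit_interval g /\
    (forall t p, C t -> (forall z, Phi t z = dZ p z) -> g t = e p).
Proof.
  intros HdZ CU C0 C1 Ccl Hloop HC Honto Hcont Hbd.
  destruct (distance_to_closed_set C 0 C0 Ccl) as [D [D1 [D2 [D3 D4]]]].
  destruct (Phi_section_exists Z dZ C Phi Honto) as [tau Htau].
  exists (glued Z Phi D), (glued_dist Z Phi D), (ground Z Phi D tau), (curve Z Phi D).
  split; [|split; [|split]].
  - now apply (glued_Peano_graph Z C).
  - now apply (ground_homeo Z dZ HdZ C).
  - now apply (curve_strongly_irreducible Z C).
  - intros t p. now apply (curve_ground Z dZ C).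
Qed.

(** * A tree of points with shrinking steps *)

Section Tree.
Variable Z : Type.
Variable dZ : Z -> Z -> R.
Hypothesis HdZ : is_metric Z dZ.
Hypothesis Hcpt : compact_space Z dZ.

Lemma finite_net (e : R) : 0 < e -> exists l : list Z, forall z, exists c, In c l /\ dZ c z < e.
Proof.
  intros He. destruct HdZ as [_ [H0 [_ Htri]]].
  destruct (Hcpt (fun U => exists c, U = fun z => dZ c z < e)) as [L [HL Hcov]].
  - intros U [c ->] z Hz. exists (e - dZ c z). split; [lra|].
    intros z' Hz'. pose proof (Htri c z z'). lra.
  - intros z. exists (fun z' => dZ z z' < e). split; [exists z; reflexivity|].
    now replace (dZ z z) with 0 by (symmetry; now apply H0).
  - assert (K : exists l : list Z, forall z, (exists U, In U L /\ U z) -> exists c, In c l /\ dZ c z < e).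
    { clear Hcov. induction L as [|U L IH].
      - exists nil. intros z [U [[] _]].
      - destruct IH as [l Hl]; [intros V HV; apply HL; now right|].
        destruct (HL U (or_introl eq_refl)) as [c ->].
        exists (c :: l). intros z [V [[<-|HV] Vz]].
        + exists c. split; [now left|assumption].
        + destruct (Hl z) as [c' [Hc' Hd]]; [exists V; tauto|].
          exists c'. split; [now right|assumption]. }
    destruct K as [l Hl]. exists l. intros z. apply Hl, Hcov.
Qed.

(** If [f] were positive everywhere, the open sets where it exceeds some positive constant would
    cover [Z], and a finite subcover would bound it away from 0. *)
Lemma zero_attained_on_space (f : Z -> R) :
  (forall z z', f z <= f z' + dZ z z') -> (forall e, 0 < e -> exists z, f z < e) ->
  exists z, f z <= 0.
Proof.
  intros Hf Hinf. apply NNPP. intros N.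
  destruct (Hcpt (fun U => exists e, 0 < e /\ U = fun z => e < f z)) as [L [HL Hcov]].
  - intros U [e [He ->]] z Hz. exists (f z - e). split; [lra|].
    intros z' Hz'. pose proof (Hf z z'). lra.
  - intros z. assert (0 < f z).
    { destruct (Rle_dec (f z) 0) as [Hz|]; [|lra]. exfalso. apply N. now exists z. }
    exists (fun z' => f z / 2 < f z'). split; [|lra]. exists (f z / 2). split; [lra|reflexivity].
  - assert (K : exists e, 0 < e /\ forall z, (exists U, In U L /\ U z) -> e < f z).
    { clear Hcov. induction L as [|U L IH].
      - exists 1. split; [lra|]. intros z [U [[] _]].
      - destruct IH as [e [He H]]; [intros V HV; apply HL; now right|].
        destruct (HL U (or_introl eq_refl)) as [e' [He' ->]].
        exists (Rmin e e'). pose proof (Rmin_l e e'). pose proof (Rmin_r e e').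
        split; [now apply Rmin_pos|].
        intros z [V [[<-|HV] Vz]]; [lra|].
        assert (e < f z) by (apply H; exists V; tauto). lra. }
    destruct K as [e [He H]]. destruct (Hinf e He) as [z Hz].
    specialize (H z (Hcov z)). lra.
Qed.

Lemma finite_nat_bound (f : nat -> nat) (L : nat) : exists M, forall m, (m < L)%nat -> (f m <= M)%nat.
Proof.
  induction L as [|L [M IH]].
  - exists 0%nat. intros; lia.
  - exists (Nat.max M (f L)). intros m Hm.
    destruct (Nat.eq_dec m L) as [->|]; [lia|]. specialize (IH m). lia.
Qed.

(** Only even indices count, since the tree offers [q k] at even depth [k] only. *)
Definition covers (q : nat -> Z) (m : nat) (e : R) : Prop :=
  forall z, exists j, (j <= m)%nat /\ Nat.even j = true /\ dZ (q j) z <= e.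

(** Finite nets of mesh 1/(n+1) are enumerated by Cantor pairing, and item [i] is put at the even
    index 2(i+1). Index 0 is reserved for [y], which also pads positions beyond the end of a net. *)
Lemma dense_sequence (y : Z) : exists q : nat -> Z, q 0%nat = y /\
  forall e, 0 < e -> exists M, covers q M e.
Proof.
  destruct (dependent_free_choice (fun (n : nat) (l : list Z) =>
    forall z, exists c, In c l /\ dZ c z < / (INR n + 1))) as [net Hnet].
  { intros n. apply finite_net. apply Rinv_0_lt_compat. pose proof (pos_INR n). lra. }
  set (q' := fun i => nth (snd (Cantor.of_nat i)) (net (fst (Cantor.of_nat i))) y).
  exists (fun k => match Nat.div2 k with 0%nat => y | S i => q' i end).
  split; [reflexivity|]. intros e He.
  destruct (archimed_cor1 e He) as [n [Hn Hn0]].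
  destruct (finite_nat_bound (fun m => 2 * S (Cantor.to_nat (n, m)))%nat (length (net n))) as [M HM].
  exists M. intros z. destruct (Hnet n z) as [c [Hc Hd]].
  destruct (In_nth _ _ y Hc) as [m [Hm Em]].
  exists (2 * S (Cantor.to_nat (n, m)))%nat. split; [now apply HM|split].
  - apply Nat.even_spec. eexists; reflexivity.
  - rewrite Nat.div2_double. unfold q'. rewrite Cantor.cancel_of_to. simpl. rewrite Em.
    assert (/ (INR n + 1) < / INR n); [|lra].
    apply Rinv_lt_contravar; [|lra]. apply Rmult_lt_0_compat; apply lt_0_INR in Hn0; lra.
Qed.

Lemma bounded_space (y : Z) : exists B, 0 <= B /\ forall z z', dZ z z' <= B.
Proof.
  destruct HdZ as [Hpos [_ [Hsym Htri]]].
  destruct (finite_net 1) as [l Hl]; [lra|].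
  assert (K : exists B, 0 <= B /\ forall c, In c l -> dZ c y <= B).
  { clear Hl. induction l as [|c l [B [HB IH]]].
    - exists 0. split; [lra|]. intros c [].
    - exists (Rmax B (dZ c y)). pose proof (Rmax_l B (dZ c y)). pose proof (Rmax_r B (dZ c y)).
      split; [lra|]. intros c' [<-|Hc']; [assumption|]. specialize (IH c' Hc'). lra. }
  destruct K as [B [HB K]]. exists (2 * (B + 1)). split; [lra|].
  assert (L : forall z, dZ z y <= B + 1).
  { intros z. destruct (Hl z) as [c [Hc Hd]]. specialize (K c Hc).
    pose proof (Htri z c y). rewrite (Hsym z c) in *. lra. }
  intros z z'. pose proof (L z). pose proof (L z'). pose proof (Htri z y z').
  rewrite (Hsym y z') in *. lra.
Qed.

(* [s k] is twice the covering radius of the first [k] candidates (up to a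
   vanishing error), so a move towards a given point is still admissible at the
   time a better candidate shows up. *)
Lemma covering_radii (q : nat -> Z) : (forall e, 0 < e -> exists M, covers q M e) ->
  exists s : nat -> R, (forall k, 0 <= s k) /\
    (forall j k, (j <= k)%nat -> s k <= s j) /\
    (forall e, 0 < e -> exists n, s n < e) /\
    (forall z z', dZ z z' <= s 0%nat / 2) /\
    (forall m, covers q m (s (S m) / 2)).
Proof.
  intros Hq. destruct (bounded_space (q 0%nat)) as [B [HB Hbd]].
  destruct (dependent_free_choice (fun (m : nat) (r : R) =>
     (forall e, 0 <= e /\ covers q m e -> r <= e) /\
     (forall b, (forall e, 0 <= e /\ covers q m e -> b <= e) -> b <= r))) as [r Hr].
  { intros m. apply (inf_exists (fun e => 0 <= e /\ covers q m e) 0 B); [tauto|].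
    split; [assumption|]. intros z. exists 0%nat. repeat split; [lia|apply Hbd]. }
  assert (r0 : forall m, 0 <= r m) by (intros m; apply Hr; tauto).
  assert (rB : forall m, r m <= B).
  { intros m. apply Hr. split; [assumption|]. intros z. exists 0%nat.
    repeat split; [lia|apply Hbd]. }
  assert (rdec : forall j k, (j <= k)%nat -> r k <= r j).
  { intros j k Hjk. apply Hr. intros e [He Hc]. apply Hr. split; [assumption|].
    intros z. destruct (Hc z) as [i [Hi Hi']]. exists i. split; [lia|assumption]. }
  assert (inv : forall m, 0 < / (INR m + 1) <= 1).
  { intros m. pose proof (pos_INR m). split; [apply Rinv_0_lt_compat; lra|].
    rewrite <- Rinv_1 at 2. apply Rinv_le_contravar; lra. }
  assert (invdec : forall j k, (j <= k)%nat -> / (INR k + 1) <= / (INR j + 1)).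
  { intros j k Hjk. apply le_INR in Hjk. pose proof (pos_INR j). apply Rinv_le_contravar; lra. }
  (* The term 1/(m+1) leaves room above the infimum [r m], which need not be attained. Since [r m]
     is at most [B] and this term at most 1, the value at 0 dominates all others. *)
  exists (fun k => match k with 0%nat => 2 * (B + 1) | S m => 2 * (r m + / (INR m + 1)) end).
  split; [|split; [|split; [|split]]].
  - intros [|m]; [lra|]. specialize (r0 m). specialize (inv m). lra.
  - intros [|j] [|k] Hjk; try lia; [lra| |].
    + specialize (rB k). specialize (inv k). lra.
    + assert (r k <= r j) by (apply rdec; lia). assert (/ (INR k + 1) <= / (INR j + 1)) by (apply invdec; lia).
      lra.
  - intros e He. destruct (Hq (e / 8)) as [M HM]; [lra|].
    destruct (archimed_cor1 (e / 8)) as [n [Hn Hn0]]; [lra|].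
    exists (S (Nat.max M n)).
    assert (r (Nat.max M n) <= e / 8).
    { apply Rle_trans with (r M); [apply rdec; lia|]. apply Hr. split; [lra|assumption]. }
    assert (/ (INR (Nat.max M n) + 1) <= / (INR n + 1)) by (apply invdec; lia).
    assert (/ (INR n + 1) <= / INR n).
    { apply Rinv_le_contravar; [|lra]. apply lt_0_INR in Hn0. lra. }
    lra.
  - intros z z'. specialize (Hbd z z'). lra.
  - intros m z.
    assert (K : exists e, (0 <= e /\ covers q m e) /\ e < r m + / (INR m + 1)).
    { apply NNPP. intros N. destruct (inv m) as [I _].
      assert (r m + / (INR m + 1) <= r m); [|lra]. apply Hr. intros e He.
      destruct (Rle_dec (r m + / (INR m + 1)) e) as [|n]; [assumption|]. exfalso.
      apply N. exists e. split; [assumption|lra]. }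
    destruct K as [e [[_ He] Hlt]]. destruct (He z) as [j [Hj [Ej Hd]]].
    exists j. repeat split; try assumption. lra.
Qed.

Variable x : Z.
Variable q : nat -> Z.
Variable s : nat -> R.
Hypothesis s_pos : forall k, 0 <= s k.
Hypothesis s_dec : forall j k, (j <= k)%nat -> s k <= s j.
Hypothesis s_0 : forall z z', dZ z z' <= s 0%nat / 2.
Hypothesis s_covers : forall m, covers q m (s (S m) / 2).
Hypothesis s_lim : forall e, 0 < e -> exists n, s n < e.

(* Histories list the visited points with the most recent one first. *)
Fixpoint admissible (c : Z) (h : list Z) : Prop :=
  match h with
  | nil => True
  | p :: h' => dZ c p <= s (length h') /\ admissible c h'
  end.

(* At odd times nothing moves: the two children of such a node carry the same
   subtree, which is what later creates loops. *)
Definition next_point (b : bool) (k : nat) (h : list Z) : Z :=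
  if b then
    if excluded_middle_informative (Nat.even k = true /\ admissible (q k) h)
    then q k else hd x h
  else hd x h.

Fixpoint history (w : list bool) : list Z :=
  match w with
  | nil => x :: nil
  | b :: w' => next_point b (length w') (history w') :: history w'
  end.

Definition node (w : list bool) : Z := hd x (history w).

Lemma history_cons (w : list bool) :
  exists h, history w = node w :: h /\ length h = length w.
Proof.
  induction w as [|b w [h [E L]]].
  - exists nil. auto.
  - exists (history w). split; [reflexivity|]. rewrite E. simpl. now rewrite L.
Qed.

Lemma node_admissible (w : list bool) : admissible (node w) (history w).
Proof.
  destruct HdZ as [_ [H0 _]].
  assert (Hrefl : forall z k, dZ z z <= s k).
  { intros z k. replace (dZ z z) with 0 by (symmetry; now apply H0). apply s_pos. }
  induction w as [|b w IH].
  - simpl. split; [apply Hrefl|exact I].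
  - change (history (b :: w)) with (node (b :: w) :: history w).
    split; [apply Hrefl|].
    change (node (b :: w)) with (next_point b (length w) (history w)).
    unfold next_point. destruct b; [|exact IH].
    destruct excluded_middle_informative as [[_ A]|]; [exact A|exact IH].
Qed.

(** Admissibility tests a candidate against every ancestor, so the bound is independent of the
    length of [u] and no steps are summed. Words grow at the head: [w] is an ancestor of
    [u ++ w]. *)
Lemma node_close (u w : list bool) : dZ (node (u ++ w)) (node w) <= s (length w).
Proof.
  assert (K : forall c u, admissible c (history (u ++ w)) -> admissible c (history w)).
  { intros c v. induction v as [|b v IH]; simpl; [tauto|]. intros [_ A]. auto. }
  pose proof (K _ _ (node_admissible (u ++ w))) as A.
  destruct (history_cons w) as [h [E L]]. rewrite E in A. simpl in A.
  rewrite L in A. tauto.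
Qed.

Lemma node_false (w : list bool) : node (false :: w) = node w.
Proof. reflexivity. Qed.

(** [s 0] is at least twice the diameter, so the first move may go anywhere; this puts the
    prescribed point [y] at the far end of the curve. *)
Lemma node_single_true : node (true :: nil) = q 0%nat.
Proof.
  unfold node. simpl. destruct excluded_middle_informative as [|n]; [reflexivity|].
  exfalso. apply n. split; [reflexivity|]. simpl. split; [|exact I].
  apply Rle_trans with (s 0%nat / 2); [apply s_0|]. pose proof (s_pos 0). lra.
Qed.

(** At odd depth both letters yield the same history, hence the same subtree. The two nodes compared
    are the values at the ends of the middle gap of the interval addressed by [w]. *)
Lemma node_dummy (w : list bool) : Nat.even (length w) = false ->
  node (true :: false :: w) = node (true :: true :: w).
Proof.
  intros Hodd.
  assert (E : history (true :: w) = history (false :: w)).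
  { simpl. rewrite Hodd. destruct excluded_middle_informative as [[? _]|]; [discriminate|reflexivity]. }
  change (node (true :: true :: w)) with (next_point true (S (length w)) (history (true :: w))).
  now rewrite E.
Qed.

Fixpoint half_close (z : Z) (h : list Z) : Prop :=
  match h with
  | nil => True
  | p :: h' => dZ p z <= s (length h') / 2 /\ half_close z h'
  end.

(** Triangle inequality through the target [z], each side using half the tolerance. A history at
    depth [k] has [k + 1] entries, all with tolerance at least [s k]. *)
Lemma half_close_admissible (z c : Z) (h : list Z) (k : nat) :
  (length h <= S k)%nat -> half_close z h -> dZ c z <= s k / 2 -> admissible c h.
Proof.
  destruct HdZ as [_ [_ [Hsym Htri]]].
  induction h as [|p h IH]; simpl; [tauto|]. intros Hl [Hp Hh] Hc. split.
  - assert (s k <= s (length h)) by (apply s_dec; lia).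
    pose proof (Htri c z p). rewrite (Hsym z p) in *. lra.
  - apply IH; [lia|assumption|assumption].
Qed.

(** Follow [z] greedily: move to the candidate whenever it is strictly closer to [z] than the
    current node and within half the current tolerance. Staying half close keeps such moves
    admissible. *)
Lemma node_greedy (z : Z) (m : nat) : exists w, length w = m /\ half_close z (history w) /\
  forall j, (j < m)%nat -> Nat.even j = true -> dZ (q j) z <= s j / 2 -> dZ (node w) z <= dZ (q j) z.
Proof.
  induction m as [|m [w [L [HC HG]]]].
  - exists nil. split; [reflexivity|split].
    + simpl. split; [apply s_0|exact I].
    + intros; lia.
  - destruct (history_cons w) as [h [Eh Lh]].
    assert (step : exists b, dZ (node (b :: w)) z <= dZ (node w) z /\
       (Nat.even m = true -> dZ (q m) z <= s m / 2 -> dZ (node (b :: w)) z <= dZ (q m) z)).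
    { destruct (classic (Nat.even m = true /\ dZ (q m) z <= s m / 2 /\ dZ (q m) z < dZ (node w) z))
        as [[E [Hs Hlt]]|N].
      - exists true.
        replace (node (true :: w)) with (q m); [split; intros; lra|].
        unfold node. simpl. rewrite L. destruct excluded_middle_informative as [|n]; [reflexivity|].
        exfalso. apply n. split; [assumption|].
        apply (half_close_admissible z _ _ m); try assumption.
        rewrite Eh. simpl. lia.
      - exists false. rewrite node_false. split; [lra|]. intros E Hs.
        destruct (Rle_dec (dZ (node w) z) (dZ (q m) z)) as [|n]; [assumption|].
        exfalso. apply N. repeat split; try assumption. lra. }
    destruct step as [b [S1 S2]].
    assert (HG' : forall j, (j < S m)%nat -> Nat.even j = true -> dZ (q j) z <= s j / 2 ->
       dZ (node (b :: w)) z <= dZ (q j) z).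
    { intros j Hj Ej Hs. destruct (Nat.eq_dec j m) as [->|Nj]; [auto|].
      apply Rle_trans with (dZ (node w) z); [assumption|]. apply HG; try assumption. lia. }
    exists (b :: w). split; [simpl; lia|split; [|exact HG']].
    change (history (b :: w)) with (node (b :: w) :: history w). simpl. split; [|exact HC].
    rewrite Eh. simpl. rewrite Lh, L.
    (* The candidate realizing the covering bound was within [s j / 2] of [z] when it was offered,
       since [s] decreases; the greedy node is at least as close. *)
    destruct (s_covers m z) as [j [Hj [Ej Hd]]].
    apply Rle_trans with (dZ (q j) z); [|assumption]. apply HG'; [lia|assumption|].
    assert (s (S m) <= s j) by (apply s_dec; lia). lra.
Qed.

Lemma node_dense (z : Z) (e : R) : 0 < e -> exists w, dZ (node w) z < e.
Proof.
  intros He. destruct (s_lim e He) as [n Hn].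
  destruct (node_greedy z n) as [w [L [HC _]]]. exists w.
  destruct (history_cons w) as [h [Eh Lh]]. rewrite Eh in HC. simpl in HC.
  rewrite Lh, L in HC. pose proof (s_pos n). lra.
Qed.

End Tree.

Lemma tree_exists (Z : Type) (dZ : Z -> Z -> R) (x y : Z) :
  is_metric Z dZ -> compact_space Z dZ ->
  exists (P : list bool -> Z) (s : nat -> R),
    P nil = x /\ P (true :: nil) = y /\
    (forall w, P (false :: w) = P w) /\
    (forall u w, dZ (P (u ++ w)) (P w) <= s (length w)) /\
    (forall w, Nat.even (length w) = false -> P (true :: false :: w) = P (true :: true :: w)) /\
    (forall z e, 0 < e -> exists w, dZ (P w) z < e) /\
    (forall j k, (j <= k)%nat -> s k <= s j) /\
    (forall e, 0 < e -> exists n, s n < e).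
Proof.
  intros HdZ Hcpt.
  destruct (dense_sequence Z dZ HdZ Hcpt y) as [q [Eq Hq]].
  destruct (covering_radii Z dZ HdZ Hcpt q Hq) as [s [s1 [s2 [s3 [s4 s5]]]]].
  exists (node Z dZ x q s), s.
  split; [reflexivity|]. split; [rewrite <- Eq; now apply node_single_true|].
  split; [now apply node_false|]. split; [now apply node_close|].
  split; [now apply node_dummy|]. split; [now apply node_dense|]. tauto.
Qed.

(** * The Cantor set and the interpolated curve *)

Lemma Rabs_le_inv (a b : R) : Rabs a <= b -> - b <= a <= b.
Proof. unfold Rabs. destruct Rcase_abs; lra. Qed.

Lemma iter_succ_inner {A : Type} (f : A -> A) (n : nat) (t : A) :
  Nat.iter (S n) f t = Nat.iter n f (f t).
Proof. induction n as [|n IH]; [reflexivity|]. simpl in *. now rewrite IH. Qed.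

Definition tent (t : R) : R := 3 * Rmin t (1 - t).

(* The middle-thirds Cantor set: the points whose orbit under the slope-3 tent
   map never leaves [0,1]. *)
Definition cantor (t : R) : Prop := forall n, unit_interval (Nat.iter n tent t).

(* The inverse branches of [tent]; the right one reverses orientation, so the
   two ends of a gap carry addresses that differ in a single letter. *)
Definition branch (b : bool) (t : R) : R := if b then 1 - t / 3 else t / 3.

(** The head of the word is the innermost branch, in accordance with tree words that grow at the
    head. *)
Fixpoint iota (w : list bool) (t : R) : R :=
  match w with nil => t | b :: w' => iota w' (branch b t) end.

Lemma branch_unit (b : bool) (t : R) : unit_interval t -> unit_interval (branch b t).
Proof. unfold unit_interval, branch. destruct b; lra. Qed.

Lemma tent_branch (b : bool) (t : R) : unit_interval t -> tent (branch b t) = t.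
Proof.
  unfold unit_interval, branch, tent, Rmin. intros H. destruct b; destruct Rle_dec; lra.
Qed.

Lemma branch_tent (t : R) : exists b, t = branch b (tent t).
Proof.
  unfold branch, tent, Rmin. destruct (Rle_dec t (1 - t)).
  - exists false. lra.
  - exists true. lra.
Qed.

Lemma cantor_unit (t : R) : cantor t -> unit_interval t.
Proof. intros H. exact (H 0%nat). Qed.

Lemma cantor_tent (t : R) : cantor t <-> unit_interval t /\ cantor (tent t).
Proof.
  split.
  - intros H. split; [exact (H 0%nat)|]. intros n. rewrite <- iter_succ_inner. apply H.
  - intros [H0 H] [|n]; [exact H0|]. rewrite iter_succ_inner. apply H.
Qed.

Lemma cantor_branch (b : bool) (t : R) : unit_interval t -> (cantor (branch b t) <-> cantor t).
Proof.
  intros Ht. rewrite cantor_tent, tent_branch by assumption.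
  pose proof (branch_unit b t Ht). tauto.
Qed.

Lemma cantor_iota (w : list bool) (t : R) : unit_interval t -> (cantor (iota w t) <-> cantor t).
Proof.
  revert t. induction w as [|b w IH]; intros t Ht; simpl; [tauto|].
  rewrite IH by now apply branch_unit. now apply cantor_branch.
Qed.

Lemma cantor_0 : cantor 0.
Proof.
  assert (K : tent 0 = 0) by (unfold tent, Rmin; destruct Rle_dec; lra).
  intros n. induction n as [|n IH].
  - unfold unit_interval. simpl. lra.
  - now rewrite iter_succ_inner, K.
Qed.

Lemma cantor_1 : cantor 1.
Proof.
  apply cantor_tent. split; [unfold unit_interval; lra|].
  replace (tent 1) with 0; [exact cantor_0|]. unfold tent, Rmin; destruct Rle_dec; lra.
Qed.

Lemma not_cantor_middle (t : R) : 1 / 3 < t < 2 / 3 -> ~ cantor t.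
Proof.
  intros Ht H. apply cantor_tent in H. destruct H as [_ H]. apply cantor_unit in H.
  unfold unit_interval, tent, Rmin in H. destruct Rle_dec; lra.
Qed.

Lemma cantor_address (t : R) (n : nat) : cantor t ->
  exists w t', length w = n /\ cantor t' /\ t = iota w t'.
Proof.
  intros Ct. induction n as [|n [w [t' [L [Ct' E]]]]].
  - exists nil, t. auto.
  - destruct (branch_tent t') as [b Eb]. exists (b :: w), (tent t'). split; [simpl; lia|split].
    + now apply (proj1 (cantor_tent t')).
    + simpl. now rewrite <- Eb.
Qed.

Lemma tent_lip (s t : R) : Rabs (tent s - tent t) <= 3 * Rabs (s - t).
Proof.
  unfold tent, Rmin, Rabs. repeat destruct Rle_dec; repeat destruct Rcase_abs; lra.
Qed.

Lemma tent_iter_lip (n : nat) (s t : R) :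
  Rabs (Nat.iter n tent s - Nat.iter n tent t) <= 3 ^ n * Rabs (s - t).
Proof.
  induction n as [|n IH]; simpl; [lra|].
  eapply Rle_trans; [apply tent_lip|]. lra.
Qed.

(** A point outside leaves [0,1] at some step [n]; nearby points leave it at the same step, because
    the n-th iterate is 3^n-Lipschitz. *)
Lemma cantor_closed : is_closed_in_R cantor.
Proof.
  intros t Nt. apply not_all_ex_not in Nt. destruct Nt as [n Hn].
  set (v := Nat.iter n tent t) in *.
  assert (Hr : exists r, 0 < r /\ forall v', Rabs (v - v') < r -> ~ unit_interval v').
  { unfold unit_interval in *. destruct (Rlt_dec v 0).
    - exists (- v). split; [lra|]. intros v' H. apply Rabs_def2 in H. lra.
    - exists (v - 1). split; [lra|]. intros v' H. apply Rabs_def2 in H. lra. }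
  destruct Hr as [r [Hr H]].
  assert (H3 : 0 < 3 ^ n) by (apply pow_lt; lra).
  exists (r / 3 ^ n). split; [now apply Rdiv_lt_0_compat|].
  intros u Hu Cu. apply (H (Nat.iter n tent u)); [|apply Cu].
  eapply Rle_lt_trans; [apply tent_iter_lip|].
  apply Rmult_lt_compat_l with (r := 3 ^ n) in Hu; [|assumption].
  replace (3 ^ n * (r / 3 ^ n)) with r in Hu by (field; lra). assumption.
Qed.

Lemma iota_affine (w : list bool) : exists a c, Rabs c = (/ 3) ^ length w /\
  forall t, iota w t = a + c * t.
Proof.
  induction w as [|b w [a [c [Hc H]]]].
  - exists 0, 1. simpl. split; [apply Rabs_R1|]. intros; ring.
  - destruct b.
    + exists (a + c), (- c / 3). split.
      * unfold Rdiv. rewrite Rabs_mult, Rabs_Ropp, Hc, (Rabs_right (/ 3)) by lra. simpl. ring.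
      * intros t. simpl. rewrite H. unfold branch. field.
    + exists a, (c / 3). split.
      * unfold Rdiv. rewrite Rabs_mult, Hc, (Rabs_right (/ 3)) by lra. simpl. ring.
      * intros t. simpl. rewrite H. unfold branch. field.
Qed.

Lemma zero_attained_on_closed (C : R -> Prop) (f : R -> R) :
  (forall t, C t -> unit_interval t) -> is_closed_in_R C ->
  continuous_on Rdist Rdist unit_interval f ->
  (forall e, 0 < e -> exists t, C t /\ f t < e) -> exists t, C t /\ f t <= 0.
Proof.
  intros CU Ccl Hf Hinf. apply NNPP. intros N.
  assert (K : exists e, 0 < e /\ forall t, 0 <= t <= 1 -> C t -> e <= f t).
  { apply (interval_local_to_global
      (fun a b => exists e, 0 < e /\ forall t, a <= t <= b -> C t -> e <= f t) 0 1); [lra| |].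
    - intros u v w H1 H2 H3 H4 [e [He K]] [e' [He' K']].
      exists (Rmin e e'). pose proof (Rmin_l e e'). pose proof (Rmin_r e e').
      split; [now apply Rmin_pos|]. intros t Ht Ct.
      destruct (Rle_dec t v).
      + assert (e <= f t) by (apply K; [lra|assumption]). lra.
      + assert (e' <= f t) by (apply K'; [lra|assumption]). lra.
    - intros t Ht. destruct (classic (C t)) as [Ct|NC].
      + assert (0 < f t).
        { destruct (Rle_dec (f t) 0); [|lra]. exfalso. apply N. now exists t. }
        destruct (Hf t Ht (f t / 2)) as [eta [He H']]; [lra|].
        exists eta. split; [assumption|]. intros u v H1 H2 H3 H4 H5 H6.
        exists (f t / 2). split; [lra|]. intros t' Ht' _.
        assert (K := H' t' ltac:(unfold unit_interval; lra) ltac:(apply Rdist_lt; lra)).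
        apply Rdist_lt in K. lra.
      + destruct (Ccl t NC) as [r [Hr H]]. exists r. split; [assumption|].
        intros u v H1 H2 H3 H4 H5 H6. exists 1. split; [lra|].
        intros t' Ht' Ct'. exfalso. apply (H t'); [apply Rabs_def1; lra|assumption]. }
  destruct K as [e [He K]]. destruct (Hinf e He) as [t [Ct Hlt]].
  specialize (K t (CU t Ct) Ct). lra.
Qed.

(** The supremum of the lower bounds [u m - e m] works, as each of them lies below every upper bound
    [u k + e k]. *)
Lemma limit_exists (u e : nat -> R) :
  (forall m k, Rabs (u (m + k)%nat - u m) <= e m) -> (forall eps, 0 < eps -> exists n, e n < eps) ->
  exists l, forall m, Rabs (l - u m) <= e m.
Proof.
  intros Hu He.
  destruct (sup_exists (fun x => exists m, x = u m - e m) (u 0%nat + e 0%nat) (u 0%nat - e 0%nat))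
    as [l [Hl1 Hl2]].
  - intros v [m ->]. pose proof (Hu 0%nat m) as H. pose proof (Hu m 0%nat) as H'.
    rewrite Nat.add_0_r in H'. simpl in H. apply Rabs_le_inv in H, H'. lra.
  - exists 0%nat. reflexivity.
  - exists l. intros m.
    assert (u m - e m <= l) by (apply Hl1; now exists m).
    assert (l <= u m + e m); [|apply Rabs_le; lra].
    apply Hl2. intros v [k ->].
    pose proof (Hu m k) as Hmk. pose proof (Hu k m) as Hkm.
    rewrite (Nat.add_comm k m) in Hkm. apply Rabs_le_inv in Hmk, Hkm. lra.
Qed.

Lemma lipschitz_glue (f : R -> R) (L a b c : R) : a <= b <= c ->
  (forall s t, a <= s <= b -> a <= t <= b -> Rabs (f s - f t) <= L * Rabs (s - t)) ->
  (forall s t, b <= s <= c -> b <= t <= c -> Rabs (f s - f t) <= L * Rabs (s - t)) ->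
  forall s t, a <= s <= c -> a <= t <= c -> Rabs (f s - f t) <= L * Rabs (s - t).
Proof.
  intros Habc H1 H2.
  assert (K : forall s t, a <= s <= b -> b <= t <= c -> Rabs (f s - f t) <= L * Rabs (s - t)).
  { intros s t Hs Ht. pose proof (H1 s b Hs ltac:(lra)) as K1. pose proof (H2 b t ltac:(lra) Ht) as K2.
    rewrite (Rabs_left1 (s - b)) in K1 by lra. rewrite (Rabs_left1 (b - t)) in K2 by lra.
    rewrite (Rabs_left1 (s - t)) by lra.
    replace (f s - f t) with ((f s - f b) + (f b - f t)) by ring.
    pose proof (Rabs_triang (f s - f b) (f b - f t)). lra. }
  intros s t Hs Ht.
  destruct (Rle_dec s b); destruct (Rle_dec t b).
  - apply H1; lra.
  - apply K; lra.
  - rewrite (Rabs_minus_sym (f s)), (Rabs_minus_sym s). apply K; lra.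
  - apply H2; lra.
Qed.

(** * The limit of the polygonal curves along a tree *)

Section TreeCurve.
Variable Z : Type.
Variable dZ : Z -> Z -> R.
Hypothesis HdZ : is_metric Z dZ.
Hypothesis Hcpt : compact_space Z dZ.
Variable P : list bool -> Z.
Variable s : nat -> R.
Hypothesis P_false : forall w, P (false :: w) = P w.
Hypothesis P_close : forall u w, dZ (P (u ++ w)) (P w) <= s (length w).
Hypothesis P_dummy : forall w, Nat.even (length w) = false ->
  P (true :: false :: w) = P (true :: true :: w).
Hypothesis P_dense : forall z e, 0 < e -> exists w, dZ (P w) z < e.
Hypothesis s_dec : forall j k, (j <= k)%nat -> s k <= s j.
Hypothesis s_lim : forall e, 0 < e -> exists n, s n < e.

Lemma dZ_lip (p p' z : Z) : Rabs (dZ p z - dZ p' z) <= dZ p p'.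
Proof.
  destruct HdZ as [_ [_ [Hsym Htri]]]. apply Rabs_le.
  pose proof (Htri p p' z). pose proof (Htri p' p z). rewrite (Hsym p' p) in *. lra.
Qed.

(* The polygonal curve from [P w] to [P (true :: w)], in the coordinates
   [dZ _ z], refined [m] times. *)
Fixpoint polygon (m : nat) (w : list bool) (t : R) (z : Z) : R :=
  match m with
  | 0%nat => (1 - t) * dZ (P w) z + t * dZ (P (true :: w)) z
  | S m' =>
    if Rle_dec t (1/3) then polygon m' (false :: w) (3 * t) z
    else if Rle_dec (2/3) t then polygon m' (true :: w) (3 - 3 * t) z
    else (2 - 3 * t) * dZ (P (true :: false :: w)) z + (3 * t - 1) * dZ (P (true :: true :: w)) z
  end.

(** Parameter 0 descends through [false] children, which carry the same point, so refinement leaves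
    the end values unchanged. *)
Lemma polygon_0 (m : nat) (w : list bool) (z : Z) : polygon m w 0 z = dZ (P w) z.
Proof.
  revert w. induction m as [|m IH]; intros w; simpl; [ring|].
  destruct Rle_dec; [|lra]. now rewrite Rmult_0_r, IH, P_false.
Qed.

Lemma polygon_1 (m : nat) (w : list bool) (z : Z) : polygon m w 1 z = dZ (P (true :: w)) z.
Proof.
  destruct m as [|m]; simpl; [ring|].
  destruct Rle_dec; [lra|]. destruct Rle_dec; [|lra].
  replace (3 - 3 * 1) with 0 by ring. apply polygon_0.
Qed.

Lemma polygon_branch (m : nat) (b : bool) (w : list bool) (t : R) (z : Z) : unit_interval t ->
  polygon (S m) w (branch b t) z = polygon m (b :: w) t z.
Proof.
  unfold unit_interval. intros Ht. simpl. destruct b; simpl.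
  - destruct Rle_dec; [lra|]. destruct Rle_dec; [|lra]. f_equal. lra.
  - destruct Rle_dec; [|lra]. f_equal. lra.
Qed.

Lemma convex_combination_close (a b c r t : R) : unit_interval t ->
  Rabs (a - c) <= r -> Rabs (b - c) <= r -> Rabs ((1 - t) * a + t * b - c) <= r.
Proof.
  unfold unit_interval. intros Ht Ha Hb. apply Rabs_le_inv in Ha, Hb. apply Rabs_le. nra.
Qed.

(** Every value is a convex combination of the coordinates of two descendants of [w]. A free centre
    [c] and radius [r] let the induction pass to children. *)
Lemma polygon_close_aux (m : nat) (w : list bool) (t c r : R) (z : Z) : unit_interval t ->
  (forall u, Rabs (dZ (P (u ++ w)) z - c) <= r) -> Rabs (polygon m w t z - c) <= r.
Proof.
  revert w t. induction m as [|m IH]; intros w t Ht H; simpl.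
  - apply convex_combination_close; [assumption|apply (H nil)|apply (H (true :: nil))].
  - assert (H' : forall b u, Rabs (dZ (P (u ++ b :: w)) z - c) <= r).
    { intros b u. specialize (H (u ++ b :: nil)). now rewrite <- app_assoc in H. }
    unfold unit_interval in Ht.
    destruct Rle_dec; [apply IH; [unfold unit_interval; lra|apply H']|].
    destruct Rle_dec; [apply IH; [unfold unit_interval; lra|apply H']|].
    replace (2 - 3 * t) with (1 - (3 * t - 1)) by ring.
    apply convex_combination_close; [unfold unit_interval; lra| |].
    + apply (H' false (true :: nil)).
    + apply (H' true (true :: nil)).
Qed.

Lemma polygon_close (m : nat) (w : list bool) (t : R) (z : Z) : unit_interval t ->
  Rabs (polygon m w t z - dZ (P w) z) <= s (length w).
Proof.
  intros Ht. apply polygon_close_aux; [assumption|]. intros u.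
  eapply Rle_trans; [apply dZ_lip|apply P_close].
Qed.

Lemma s_nonneg (k : nat) : 0 <= s k.
Proof.
  destruct HdZ as [Hpos _].
  pose proof (P_close nil (repeat true k)) as H. rewrite repeat_length in H.
  eapply Rle_trans; [apply Hpos|exact H].
Qed.

(** Both refinements descend together for [m] levels and then stay close to the same node; in a gap
    met on the way they agree exactly. *)
Lemma polygon_cauchy (m k : nat) (w : list bool) (t : R) (z : Z) : unit_interval t ->
  Rabs (polygon (m + k) w t z - polygon m w t z) <= 2 * s (length w + m)%nat.
Proof.
  revert w t. induction m as [|m IH]; intros w t Ht.
  - rewrite Nat.add_0_r.
    pose proof (polygon_close k w t z Ht) as H1. pose proof (polygon_close 0 w t z Ht) as H2.
    change (0 + k)%nat with k. apply Rabs_le_inv in H1, H2. apply Rabs_le. lra.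
  - assert (IH' : forall b t, unit_interval t -> Rabs (polygon (m + k) (b :: w) t z -
      polygon m (b :: w) t z) <= 2 * s (length w + S m)%nat).
    { intros b t' Ht'. specialize (IH (b :: w) t' Ht'). simpl in IH.
      now replace (length w + S m)%nat with (S (length w + m)) by lia. }
    unfold unit_interval in Ht. simpl.
    destruct Rle_dec; [apply IH'; unfold unit_interval; lra|].
    destruct Rle_dec; [apply IH'; unfold unit_interval; lra|].
    unfold Rminus. rewrite Rplus_opp_r, Rabs_R0. pose proof (s_nonneg (length w + S m)). lra.
Qed.

Lemma P_bounded (u v : list bool) (z : Z) : Rabs (dZ (P u) z - dZ (P v) z) <= 2 * s 0%nat.
Proof.
  destruct HdZ as [_ [_ [Hsym Htri]]].
  eapply Rle_trans; [apply dZ_lip|].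
  pose proof (P_close u nil) as H1. pose proof (P_close v nil) as H2.
  rewrite app_nil_r in H1, H2. simpl in *.
  pose proof (Htri (P u) (P nil) (P v)). rewrite (Hsym (P nil) (P v)) in *. lra.
Qed.

(** The constant grows with [m], but uniform continuity of the limit needs just one [m] for each
    accuracy. It is uniform in [w] and [z]. *)
Lemma polygon_lip (m : nat) : exists L, 0 <= L /\ forall w t t' z,
  0 <= t <= 1 -> 0 <= t' <= 1 -> Rabs (polygon m w t z - polygon m w t' z) <= L * Rabs (t - t').
Proof.
  induction m as [|m [L [HL IH]]].
  - exists (2 * s 0%nat). split; [pose proof (s_nonneg 0); lra|]. intros w t t' z Ht Ht'. simpl.
    replace (_ - _) with ((dZ (P (true :: w)) z - dZ (P w) z) * (t - t')) by ring.
    rewrite Rabs_mult. apply Rmult_le_compat_r; [apply Rabs_pos|]. apply P_bounded.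
  - set (B := 2 * s 0%nat). assert (HB : 0 <= B) by (unfold B; pose proof (s_nonneg 0); lra).
    exists (3 * L + 3 * B). split; [lra|]. intros w t t' z Ht Ht'.
    set (f := fun t => polygon (S m) w t z).
    change (Rabs (f t - f t') <= (3 * L + 3 * B) * Rabs (t - t')).
    assert (F1 : forall t, 0 <= t <= 1/3 -> f t = polygon m (false :: w) (3 * t) z).
    { intros v Hv. unfold f. simpl. destruct Rle_dec; [reflexivity|lra]. }
    assert (F3 : forall t, 2/3 <= t <= 1 -> f t = polygon m (true :: w) (3 - 3 * t) z).
    { intros v Hv. unfold f. simpl. destruct Rle_dec; [lra|]. destruct Rle_dec; [reflexivity|lra]. }
    (* The middle formula extends to 1/3 and 2/3 because the reflected right third also meets the
       gap at its parameter 1. *)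
    assert (F2 : forall t, 1/3 <= t <= 2/3 -> f t =
      (2 - 3 * t) * dZ (P (true :: false :: w)) z + (3 * t - 1) * dZ (P (true :: true :: w)) z).
    { intros v Hv. destruct (Req_dec v (1/3)) as [->|N1].
      - rewrite F1 by lra. replace (3 * (1/3)) with 1 by field. rewrite polygon_1. field.
      - destruct (Req_dec v (2/3)) as [->|N2].
        + rewrite F3 by lra. replace (3 - 3 * (2/3)) with 1 by field. rewrite polygon_1. field.
        + unfold f. simpl. destruct Rle_dec; [lra|]. destruct Rle_dec; [lra|reflexivity]. }
    apply (lipschitz_glue f _ 0 (1/3) 1); try lra.
    + intros u v Hu Hv. rewrite !F1 by assumption.
      eapply Rle_trans; [apply IH; lra|].
      replace (3 * u - 3 * v) with (3 * (u - v)) by ring.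
      rewrite Rabs_mult, (Rabs_right 3) by lra. pose proof (Rabs_pos (u - v)). nra.
    + apply (lipschitz_glue f _ (1/3) (2/3) 1); try lra.
      * intros u v Hu Hv. rewrite !F2 by assumption.
        replace (_ - _) with
          (3 * (dZ (P (true :: true :: w)) z - dZ (P (true :: false :: w)) z) * (u - v)) by ring.
        rewrite !Rabs_mult, (Rabs_right 3) by lra.
        pose proof (P_bounded (true :: true :: w) (true :: false :: w) z) as H. fold B in H.
        pose proof (Rabs_pos (u - v)). apply Rmult_le_compat_r; lra.
      * intros u v Hu Hv. rewrite !F3 by assumption.
        eapply Rle_trans; [apply IH; lra|].
        replace (3 - 3 * u - (3 - 3 * v)) with ((- 3) * (u - v)) by ring.
        rewrite Rabs_mult, (Rabs_left (-3)) by lra. pose proof (Rabs_pos (u - v)). nra.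
Qed.

(** Convergence is stated through its rate; since [s] tends to 0, this determines [Phi] on [0,1]. *)
Definition is_limit_curve (Phi : list bool -> R -> Z -> R) : Prop :=
  forall w t z m, unit_interval t -> Rabs (Phi w t z - polygon m w t z) <= 2 * s (length w + m)%nat.

Lemma limit_curve_exists : exists Phi, is_limit_curve Phi.
Proof.
  destruct (dependent_free_choice (fun (i : list bool * R * Z) l =>
    let '(w, t, z) := i in unit_interval t ->
      forall m, Rabs (l - polygon m w t z) <= 2 * s (length w + m)%nat)) as [F HF].
  { intros [[w t] z]. destruct (classic (unit_interval t)) as [Ht|N]; [|exists 0; tauto].
    destruct (limit_exists (fun m => polygon m w t z) (fun m => 2 * s (length w + m)%nat)) as [l Hl].
    - intros m k. now apply polygon_cauchy.
    - intros e He. destruct (s_lim (e / 2)) as [n Hn]; [lra|]. exists n.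
      assert (s (length w + n)%nat <= s n) by (apply s_dec; lia). lra.
    - exists l. auto. }
  exists (fun w t z => F (w, t, z)). intros w t z m Ht. exact (HF (w, t, z) Ht m).
Qed.

Variable Phi : list bool -> R -> Z -> R.
Hypothesis Phi_limit : is_limit_curve Phi.

Lemma limit_curve_unique (w w' : list bool) (t t' : R) (z : Z) (k : nat) :
  unit_interval t -> unit_interval t' ->
  (forall m, polygon (k + m) w t z = polygon m w' t' z) -> Phi w t z = Phi w' t' z.
Proof.
  intros Ht Ht' E. apply Rabs_eq0_of_eps. intros e He.
  destruct (s_lim (e / 4)) as [n Hn]; [lra|].
  pose proof (Phi_limit w t z (k + n)%nat Ht) as H1. pose proof (Phi_limit w' t' z n Ht') as H2.
  rewrite E in H1.
  assert (s (length w + (k + n))%nat <= s n) by (apply s_dec; lia).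
  assert (s (length w' + n)%nat <= s n) by (apply s_dec; lia).
  apply Rabs_le_inv in H1, H2. apply Rabs_le. lra.
Qed.

(** Self-similarity: over the interval addressed by [w], the curve is the limit curve of the subtree
    at [w]. *)
Lemma Phi_iota (w : list bool) (t : R) (z : Z) : unit_interval t ->
  Phi nil (iota w t) z = Phi w t z.
Proof.
  revert t. induction w as [|b w IH]; intros t Ht; [reflexivity|]. simpl.
  rewrite IH by now apply branch_unit.
  apply (limit_curve_unique _ _ _ _ _ 1); [now apply branch_unit|assumption|].
  intros m. now apply polygon_branch.
Qed.

Lemma Phi_value (w : list bool) (t : R) (z : Z) (v : R) : unit_interval t ->
  (forall m, polygon m w t z = v) -> Phi w t z = v.
Proof.
  intros Ht E. apply Rabs_eq0_of_eps. intros e He.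
  destruct (s_lim (e / 2)) as [n Hn]; [lra|].
  pose proof (Phi_limit w t z n Ht) as H. rewrite E in H.
  assert (s (length w + n)%nat <= s n) by (apply s_dec; lia). lra.
Qed.

Lemma Phi_0 (w : list bool) (z : Z) : Phi w 0 z = dZ (P w) z.
Proof.
  apply Phi_value; [unfold unit_interval; lra|]. intros m. apply polygon_0.
Qed.

Lemma Phi_1 (w : list bool) (z : Z) : Phi w 1 z = dZ (P (true :: w)) z.
Proof.
  apply Phi_value; [unfold unit_interval; lra|]. intros m. apply polygon_1.
Qed.

Lemma Phi_close (w : list bool) (t : R) (z : Z) : unit_interval t ->
  Rabs (Phi w t z - dZ (P w) z) <= 3 * s (length w).
Proof.
  intros Ht. pose proof (Phi_limit w t z 0%nat Ht) as H1. pose proof (polygon_close 0 w t z Ht) as H2.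
  rewrite Nat.add_0_r in H1. apply Rabs_le_inv in H1, H2. apply Rabs_le. lra.
Qed.

Lemma Phi_nil_bounded : exists B, forall t t' z,
  unit_interval t -> unit_interval t' -> Rabs (Phi nil t z - Phi nil t' z) <= B.
Proof.
  exists (6 * s 0%nat). intros t t' z Ht Ht'.
  pose proof (Phi_close nil t z Ht) as H1. pose proof (Phi_close nil t' z Ht') as H2.
  simpl in *. apply Rabs_le_inv in H1, H2. apply Rabs_le. lra.
Qed.

Lemma Phi_nil_continuous (eps : R) : 0 < eps -> exists eta, 0 < eta /\
  forall t t', unit_interval t -> unit_interval t' -> Rabs (t - t') < eta ->
    forall z, Rabs (Phi nil t z - Phi nil t' z) <= eps.
Proof.
  intros He. destruct (s_lim (eps / 8)) as [n Hn]; [lra|].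
  destruct (polygon_lip n) as [L [HL H]].
  (* Each of the two limit errors takes eps/4 and the polygon eps/2; [L + 1] avoids division by
     0. *)
  exists (eps / (2 * (L + 1))). split; [apply Rdiv_lt_0_compat; lra|].
  intros t t' Ht Ht' Hd z.
  pose proof (Phi_limit nil t z n Ht) as H1. pose proof (Phi_limit nil t' z n Ht') as H2.
  specialize (H nil t t' z Ht Ht'). simpl in H1, H2.
  assert (K : (L + 1) * Rabs (t - t') <= eps / 2).
  { apply Rlt_le in Hd. apply Rmult_le_compat_l with (r := L + 1) in Hd; [|lra].
    replace ((L + 1) * (eps / (2 * (L + 1)))) with (eps / 2) in Hd by (field; lra). assumption. }
  pose proof (Rabs_pos (t - t')).
  apply Rabs_le_inv in H1, H2. assert (H' : Rabs (polygon n nil t z - polygon n nil t' z) <= eps / 2) by nra.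
  apply Rabs_le_inv in H'. apply Rabs_le. lra.
Qed.

Lemma Phi_nil_loops (t eta : R) : cantor t -> 0 < eta ->
  exists a b, a <> b /\ Rabs (a - t) < eta /\ Rabs (b - t) < eta /\ cantor a /\ cantor b /\
    (forall tau, 0 < tau < 1 -> ~ cantor (a + tau * (b - a))) /\
    (forall z, Phi nil a z = Phi nil b z).
Proof.
  intros Ct He.
  destruct (pow_lt_1_zero (/ 3)) with (y := eta) as [N HN]; [rewrite Rabs_right; lra|assumption|].
  (* Odd, so that [P_dummy] applies at this depth, and large enough to make the interval shorter
     than [eta]. *)
  set (n := S (2 * N)).
  destruct (cantor_address t n Ct) as [w [t' [L [Ct' ->]]]].
  destruct (iota_affine w) as [a [c [Hc Haff]]].
  assert (Hceta : Rabs c < eta).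
  { rewrite Hc, L. assert (H := HN n ltac:(unfold n; lia)).
    rewrite Rabs_right in H; [assumption|]. apply Rle_ge, pow_le. lra. }
  assert (Hc0 : c <> 0).
  { intros ->. rewrite Rabs_R0 in Hc. assert (0 < (/ 3) ^ length w) by (apply pow_lt; lra). lra. }
  assert (Ut' := cantor_unit t' Ct').
  assert (near : forall v, unit_interval v -> Rabs (iota w v - iota w t') < eta).
  { intros v Hv. rewrite !Haff. replace (a + c * v - (a + c * t')) with (c * (v - t')) by ring.
    rewrite Rabs_mult. unfold unit_interval in *.
    assert (Rabs (v - t') <= 1) by (apply Rabs_le; lra).
    pose proof (Rabs_pos c). pose proof (Rabs_pos (v - t')). nra. }
  assert (U1 : unit_interval 1) by (unfold unit_interval; lra).
  assert (Cbr : forall b, cantor (iota w (branch b 1))).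
  { intros b. apply cantor_iota; [now apply branch_unit|]. apply cantor_branch; [assumption|].
    exact cantor_1. }
  exists (iota w (branch false 1)), (iota w (branch true 1)).
  split; [|split; [|split; [|split; [|split; [|split]]]]]; auto using branch_unit.
  - rewrite !Haff. unfold branch. intros E. apply Hc0. lra.
  - intros tau Htau.
    replace (iota w (branch false 1) + tau * (iota w (branch true 1) - iota w (branch false 1)))
      with (iota w ((1 + tau) / 3)) by (rewrite !Haff; unfold branch; field).
    rewrite cantor_iota by (unfold unit_interval; lra). apply not_cantor_middle. lra.
  - intros z. rewrite !Phi_iota by now apply branch_unit.
    rewrite <- (Phi_iota w (branch false 1)), <- (Phi_iota w (branch true 1)) by now apply branch_unit.
    (* Absorbing the branch into the word presents both ends of the gap as parameter 1 of a child of
       [w]. *)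
    change (iota w (branch false 1)) with (iota (false :: w) 1).
    change (iota w (branch true 1)) with (iota (true :: w) 1).
    rewrite !Phi_iota, !Phi_1 by assumption. rewrite P_dummy; [reflexivity|].
    rewrite L. unfold n. rewrite Nat.even_succ, Nat.odd_mul. reflexivity.
Qed.

(** [Phi nil t] is a uniform limit of distance functions [dZ (P w)]. By compactness it has a zero
    [p], and such a limit vanishing at [p] equals [dZ p]. *)
Lemma Phi_nil_on_cantor (t : R) : cantor t -> exists p, forall z, Phi nil t z = dZ p z.
Proof.
  intros Ct. destruct HdZ as [Hpos [H0 [Hsym Htri]]].
  assert (K : forall e, 0 < e -> exists p, forall z, Rabs (Phi nil t z - dZ p z) <= e).
  { intros e He. destruct (s_lim (e / 3)) as [n Hn]; [lra|].
    destruct (cantor_address t n Ct) as [w [t' [L [Ct' ->]]]].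
    exists (P w). intros z. assert (Ut' := cantor_unit t' Ct'). rewrite Phi_iota by assumption.
    pose proof (Phi_close w t' z Ut') as H. rewrite L in H. lra. }
  destruct (zero_attained_on_space Z dZ Hcpt (Phi nil t)) as [p Hp].
  - intros z z'. apply Rle_of_eps. intros e He.
    destruct (K (e / 2)) as [p Hp]; [lra|].
    pose proof (Hp z) as H1. pose proof (Hp z') as H2. apply Rabs_le_inv in H1, H2.
    pose proof (Htri p z' z). rewrite (Hsym z' z) in *. lra.
  - intros e He. destruct (K (e / 2)) as [p Hp]; [lra|]. exists p.
    specialize (Hp p). replace (dZ p p) with 0 in Hp by (symmetry; now apply H0).
    apply Rabs_le_inv in Hp. lra.
  - exists p. intros z. apply Rabs_eq0_of_eps. intros e He.
    destruct (K (e / 2)) as [p' Hp']; [lra|].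
    pose proof (Hp' z) as H1. pose proof (Hp' p) as H2. pose proof (dZ_lip p p' z) as H3.
    rewrite (Hsym p p') in H3. apply Rabs_le_inv in H1, H2, H3. apply Rabs_le. lra.
Qed.

(** The nodes are values at the Cantor points [iota w 0] and come arbitrarily close to [p];
    compactness of the Cantor set turns this into a parameter at distance 0. *)
Lemma Phi_nil_onto (p : Z) : exists t, cantor t /\ forall z, Phi nil t z = dZ p z.
Proof.
  destruct HdZ as [Hpos [H0 [Hsym Htri]]].
  destruct (zero_attained_on_closed cantor (fun t => Phi nil t p)) as [t [Ct Ht]].
  - exact cantor_unit.
  - exact cantor_closed.
  - intros t Ut e He. destruct (Phi_nil_continuous (e / 2)) as [eta [Heta H]]; [lra|].
    exists eta. split; [assumption|]. intros t' Ut' Hd. unfold Rdist.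
    apply Rle_lt_trans with (e / 2); [|lra]. now apply H.
  - intros e He. destruct (P_dense p e He) as [w Hw].
    exists (iota w 0). split.
    + apply cantor_iota; [unfold unit_interval; lra|exact cantor_0].
    + rewrite Phi_iota, Phi_0; [assumption|unfold unit_interval; lra].
  - exists t. split; [assumption|]. destruct (Phi_nil_on_cantor t Ct) as [p' Hp'].
    rewrite Hp' in Ht. pose proof (Hpos p' p).
    assert (p' = p) by (apply H0; lra). now subst p'.
Qed.

End TreeCurve.

Theorem arc_curve_exists (Z : Type) (dZ : Z -> Z -> R) (x y : Z) :
  is_metric Z dZ -> compact_space Z dZ ->
  exists (X : Type) (dX : X -> X -> R) (e : Z -> X) (g : R -> X),
    Peano_graph X dX /\ homeo_sets dZ dX (fun _ => True) (Gr X dX) e /\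
    strongly_irreducible X dX Rdist unit_interval g /\ g 0 = e x /\ g 1 = e y.
Proof.
  intros HdZ Hcpt.
  destruct (tree_exists Z dZ x y HdZ Hcpt) as [P [s [P0 [P1 [P2 [P3 [P4 [P5 [s1 s2]]]]]]]]].
  destruct (limit_curve_exists Z dZ HdZ P s P3 s1 s2) as [Phi HPhi].
  destruct (gluing Z dZ cantor (Phi nil) HdZ cantor_unit cantor_0 cantor_1 cantor_closed)
    as [X [dX [e [g [H1 [H2 [H3 H4]]]]]]].
  - now apply (Phi_nil_loops Z dZ P s).
  - now apply (Phi_nil_on_cantor Z dZ HdZ Hcpt P s).
  - now apply (Phi_nil_onto Z dZ HdZ Hcpt P s).
  - now apply (Phi_nil_continuous Z dZ HdZ P s).
  - now apply (Phi_nil_bounded Z dZ HdZ P s).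
  - exists X, dX, e, g. split; [assumption|split; [assumption|split; [assumption|split]]].
    + apply H4; [exact cantor_0|]. intros z. rewrite <- P0. now apply (Phi_0 Z dZ P s).
    + apply H4; [exact cantor_1|]. intros z. rewrite <- P1. now apply (Phi_1 Z dZ P s).
Qed.

(** * Closing up a curve *)

(* An algebraic stand-in for the argument: each half circle is parametrized by
   its first coordinate. *)
Definition turn (p : R * R) : R :=
  if Rle_dec 0 (snd p) then (1 - fst p) / 4 else (3 + fst p) / 4.

Definition wrap (t : R) : R * R :=
  if Rle_dec t (1/2) then (1 - 4 * t, sqrt (1 - (1 - 4 * t) ^ 2))
  else (4 * t - 3, - sqrt (1 - (4 * t - 3) ^ 2)).

Lemma R2dist_sqr (p q : R * R) :
  0 <= R2dist p q /\ R2dist p q * R2dist p q = (fst p - fst q) ^ 2 + (snd p - snd q) ^ 2.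
Proof.
  unfold R2dist. split; [apply sqrt_pos|]. apply sqrt_sqrt.
  pose proof (pow2_ge_0 (fst p - fst q)). pose proof (pow2_ge_0 (snd p - snd q)). lra.
Qed.

Lemma R2dist_coords (p q : R * R) (r : R) : R2dist p q < r ->
  - r < fst p - fst q < r /\ - r < snd p - snd q < r.
Proof.
  destruct (R2dist_sqr p q) as [H0 H]. intros Hr.
  generalize dependent (R2dist p q). intros D H0 H Hr.
  assert (K : forall a, a ^ 2 <= D * D -> - r < a < r).
  { intros a Ha. assert (Rabs a <= D); [|apply Rabs_le_inv in H1; lra].
    rewrite <- (Rabs_right D) by lra. apply Rsqr_le_abs_0. unfold Rsqr. lra. }
  pose proof (pow2_ge_0 (fst p - fst q)). pose proof (pow2_ge_0 (snd p - snd q)).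
  split; apply K; lra.
Qed.

Lemma turn_unit (p : R * R) : circle p -> 0 <= turn p < 1.
Proof.
  unfold circle, turn. intros H.
  assert (-1 <= fst p <= 1) by (split; nra).
  destruct Rle_dec; [lra|]. assert (0 < snd p ^ 2) by nra.
  assert (fst p <> 1) by nra. lra.
Qed.

Lemma wrap_circle (t : R) : unit_interval t -> circle (wrap t).
Proof.
  unfold unit_interval, circle, wrap. intros Ht. destruct Rle_dec; cbn [fst snd].
  - assert (0 <= 1 - (1 - 4 * t) ^ 2) by nra. rewrite pow2_sqrt; lra.
  - assert (0 <= 1 - (4 * t - 3) ^ 2) by nra.
    replace ((- sqrt (1 - (4 * t - 3) ^ 2)) ^ 2) with ((sqrt (1 - (4 * t - 3) ^ 2)) ^ 2) by ring.
    rewrite pow2_sqrt; lra.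
Qed.

Lemma turn_wrap (t : R) : 0 <= t < 1 -> turn (wrap t) = t.
Proof.
  intros Ht. unfold turn, wrap. destruct (Rle_dec t (1/2)); simpl.
  - destruct Rle_dec as [|n]; [lra|]. exfalso. apply n. apply sqrt_pos.
  - destruct Rle_dec as [H|]; [|lra]. exfalso.
    assert (0 < sqrt (1 - (4 * t - 3) ^ 2)) by (apply sqrt_lt_R0; nra). simpl in *. lra.
Qed.

Lemma wrap_turn (p : R * R) : circle p -> wrap (turn p) = p.
Proof.
  unfold circle. destruct p as [u v]. cbn [fst snd]. intros H.
  unfold turn, wrap. cbn [fst snd]. destruct (Rle_dec 0 v).
  - destruct Rle_dec as [|n]; [|exfalso; apply n; nra].
    f_equal; [field|]. replace (1 - (1 - 4 * ((1 - u) / 4)) ^ 2) with (v ^ 2) by (field_simplify; lra).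
    now apply sqrt_pow2.
  - destruct Rle_dec as [K|].
    + exfalso. assert (u <= -1) by lra. assert (0 < v ^ 2) by nra. nra.
    + f_equal; [field|].
      replace (1 - (4 * ((3 + u) / 4) - 3) ^ 2) with ((- v) ^ 2) by (field_simplify; lra).
      rewrite sqrt_pow2; lra.
Qed.

(** Hölder continuity of exponent 1/2: |sqrt a - sqrt b| is at most sqrt a + sqrt b, and their
    product is |a - b|. *)
Lemma sqrt_diff_sqr (a b : R) : 0 <= a -> 0 <= b -> (sqrt a - sqrt b) ^ 2 <= Rabs (a - b).
Proof.
  intros Ha Hb. pose proof (sqrt_pos a). pose proof (sqrt_pos b).
  pose proof (sqrt_sqrt a Ha). pose proof (sqrt_sqrt b Hb).
  unfold Rabs. destruct Rcase_abs.
  - assert (sqrt a <= sqrt b) by (apply sqrt_le_1; lra). nra.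
  - assert (sqrt b <= sqrt a) by (apply sqrt_le_1; lra). nra.
Qed.

(** As |u - u'| < 1, the first square is at most |u - u'|; the second is at most 2|u - u'|. Hence
    the divisor 3. *)
Lemma circle_point_near (u u' eps : R) : -1 <= u <= 1 -> -1 <= u' <= 1 -> 0 < eps ->
  Rabs (u - u') < Rmin 1 (eps ^ 2 / 3) ->
  (u - u') ^ 2 + (sqrt (1 - u ^ 2) - sqrt (1 - u' ^ 2)) ^ 2 < eps ^ 2.
Proof.
  intros Hu Hu' He Hd. pose proof (Rmin_l 1 (eps ^ 2 / 3)). pose proof (Rmin_r 1 (eps ^ 2 / 3)).
  assert (K := sqrt_diff_sqr (1 - u ^ 2) (1 - u' ^ 2) ltac:(nra) ltac:(nra)).
  replace (1 - u ^ 2 - (1 - u' ^ 2)) with ((u' - u) * (u + u')) in K by ring.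
  rewrite Rabs_mult, Rabs_minus_sym in K.
  assert (Rabs (u + u') <= 2) by (apply Rabs_le; lra).
  pose proof (Rabs_pos (u - u')).
  assert ((u - u') ^ 2 = Rabs (u - u') ^ 2) by (now rewrite pow2_abs).
  nra.
Qed.

Lemma wrap_continuous : continuous_on Rdist R2dist unit_interval wrap.
Proof.
  intros t Ht eps He.
  set (m := Rmin 1 (eps ^ 2 / 3)).
  assert (Hm : 0 < m).
  { apply Rmin_pos; [lra|]. assert (0 < eps ^ 2) by (apply pow_lt; lra). lra. }
  (* Both formulas give (-1, 0) at 1/2, so each holds on a closed half; the 4 in [m / 4] below is
     the speed of the first coordinate. *)
  assert (W2 : forall t, 1/2 <= t -> wrap t = (4 * t - 3, - sqrt (1 - (4 * t - 3) ^ 2))).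
  { intros v Hv. unfold wrap. destruct Rle_dec; [|reflexivity].
    assert (v = 1/2) by lra. subst v.
    replace (1 - 4 * (1/2)) with (-1) by field. replace (4 * (1/2) - 3) with (-1) by field.
    replace (1 - (-1) ^ 2) with 0 by ring. rewrite sqrt_0. f_equal. ring. }
  assert (W1 : forall t, t <= 1/2 -> wrap t = (1 - 4 * t, sqrt (1 - (1 - 4 * t) ^ 2))).
  { intros v Hv. unfold wrap. destruct Rle_dec; [reflexivity|lra]. }
  assert (near : forall t', unit_interval t' -> Rdist t t' < m / 4 ->
    (t <= 1/2 /\ t' <= 1/2 \/ 1/2 <= t /\ 1/2 <= t') -> R2dist (wrap t) (wrap t') < eps).
  { unfold unit_interval in *. intros t' Ht' Hd Hside. apply Rdist_lt in Hd.
    destruct (R2dist_sqr (wrap t) (wrap t')) as [D0 D2].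
    assert (K : R2dist (wrap t) (wrap t') * R2dist (wrap t) (wrap t') < eps ^ 2); [|nra].
    rewrite D2. destruct Hside as [[S1 S2]|[S1 S2]].
    - rewrite !W1 by assumption. cbn [fst snd].
      apply circle_point_near; try lra. fold m. apply Rabs_def1; lra.
    - rewrite !W2 by assumption. cbn [fst snd].
      replace (- sqrt (1 - (4 * t - 3) ^ 2) - - sqrt (1 - (4 * t' - 3) ^ 2))
        with (- (sqrt (1 - (4 * t - 3) ^ 2) - sqrt (1 - (4 * t' - 3) ^ 2))) by ring.
      rewrite <- (Rsqr_pow2 (- _)), <- Rsqr_neg, Rsqr_pow2.
      apply circle_point_near; try lra. fold m. apply Rabs_def1; lra. }
  assert (side : exists del, 0 < del /\ forall t', Rdist t t' < del ->
    (t <= 1/2 /\ t' <= 1/2 \/ 1/2 <= t /\ 1/2 <= t')).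
  { destruct (Rtotal_order t (1/2)) as [H|[H|H]].
    - exists (1/2 - t). split; [lra|]. intros t' Hd. apply Rdist_lt in Hd. lra.
    - exists 1. split; [lra|]. intros t' _. lra.
    - exists (t - 1/2). split; [lra|]. intros t' Hd. apply Rdist_lt in Hd. lra. }
  destruct side as [del [Hdel side]].
  exists (Rmin del (m / 4)). split; [apply Rmin_pos; lra|].
  intros t' Ht' Hd. pose proof (Rmin_l del (m / 4)). pose proof (Rmin_r del (m / 4)).
  apply near; [assumption|lra|]. apply side. lra.
Qed.

(** [turn] itself jumps at (1, 0), where values near 0 and near 1 meet; there [g 0 = g 1] saves
    continuity. At (-1, 0) both of its formulas give 1/2. *)
Lemma turn_continuous (X : Type) (dX : X -> X -> R) (g : R -> X) :
  continuous_on Rdist dX unit_interval g -> g 0 = g 1 ->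
  continuous_on R2dist dX circle (fun p => g (turn p)).
Proof.
  intros Hg H01 p Hp eps He.
  assert (Up := turn_unit p Hp).
  destruct (Hg (turn p)) with (eps := eps) as [del [Hdel H]]; [unfold unit_interval; lra|assumption|].
  assert (main : forall q, circle q -> Rdist (turn p) (turn q) < del ->
    dX (g (turn p)) (g (turn q)) < eps).
  { intros q Hq Hd. pose proof (turn_unit q Hq). apply H; [unfold unit_interval; lra|assumption]. }
  assert (Hp' := Hp). unfold circle in Hp'.
  destruct (Rtotal_order (snd p) 0) as [Hs|[Hs|Hs]].
  - exists (Rmin del (- snd p)). split; [apply Rmin_pos; lra|]. intros q Hq Hd.
    pose proof (Rmin_l del (- snd p)). pose proof (Rmin_r del (- snd p)).
    apply R2dist_coords in Hd. apply main; [assumption|]. apply Rdist_lt. unfold turn.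
    destruct (Rle_dec 0 (snd p)); [lra|]. destruct (Rle_dec 0 (snd q)); lra.
  - rewrite Hs in Hp'.
    assert (Hf : fst p = 1 \/ fst p = -1).
    { assert (E : (fst p - 1) * (fst p + 1) = 0) by lra. apply Rmult_integral in E. lra. }
    destruct Hf as [Hf|Hf].
    + assert (T0 : turn p = 0) by (unfold turn; rewrite Hs, Hf; destruct Rle_dec; lra).
      destruct (Hg 1) with (eps := eps) as [del' [Hdel' H']]; [unfold unit_interval; lra|assumption|].
      exists (Rmin del del'). split; [now apply Rmin_pos|]. intros q Hq Hd.
      pose proof (Rmin_l del del'). pose proof (Rmin_r del del').
      apply R2dist_coords in Hd. rewrite Hf in Hd. pose proof (turn_unit q Hq) as Uq.
      destruct (Rle_dec 0 (snd q)).
      * apply main; [assumption|]. apply Rdist_lt. rewrite T0. unfold turn in *.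
        destruct (Rle_dec 0 (snd q)); lra.
      * rewrite T0, H01. apply H'; [unfold unit_interval; lra|]. apply Rdist_lt. unfold turn in *.
        destruct (Rle_dec 0 (snd q)); lra.
    + exists del. split; [assumption|]. intros q Hq Hd. apply R2dist_coords in Hd.
      apply main; [assumption|]. apply Rdist_lt. unfold turn.
      destruct (Rle_dec 0 (snd p)); [|lra]. destruct (Rle_dec 0 (snd q)); lra.
  - exists (Rmin del (snd p)). split; [apply Rmin_pos; lra|]. intros q Hq Hd.
    pose proof (Rmin_l del (snd p)). pose proof (Rmin_r del (snd p)).
    apply R2dist_coords in Hd. apply main; [assumption|]. apply Rdist_lt. unfold turn.
    destruct (Rle_dec 0 (snd p)); [|lra]. destruct (Rle_dec 0 (snd q)); lra.
Qed.

(** A closed proper subset of the circle is pulled back along [wrap], which unlike [turn] is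
    continuous; the preimage is closed and misses [turn p] for every missed [p]. *)
Lemma closed_curve_Eulerian (X : Type) (dX : X -> X -> R) (g : R -> X) :
  strongly_irreducible X dX Rdist unit_interval g -> g 0 = g 1 -> Eulerian X dX.
Proof.
  intros [Hg [Hsurj Hirr]] H01.
  exists (fun p => g (turn p)). split; [now apply turn_continuous|split].
  - assert (K : forall t, 0 <= t < 1 -> exists p, circle p /\ g (turn p) = g t).
    { intros t Ht. exists (wrap t). split; [apply wrap_circle; unfold unit_interval; lra|].
      now rewrite turn_wrap. }
    intros y. destruct (Hsurj y) as [t [Ht <-]]. unfold unit_interval in Ht.
    destruct (Req_dec t 1) as [->|N]; [rewrite <- H01|]; apply K; lra.
  - intros A [HA1 HA2] [p [Hp Np]].
    destruct (Hirr (fun t => unit_interval t /\ A (wrap t))) as [y Hy].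
    + split; [intros t; tauto|]. intros t Ut Hlim. split; [assumption|].
      apply HA2; [now apply wrap_circle|]. intros r Hr.
      destruct (wrap_continuous t Ut r Hr) as [del [Hdel H]].
      destruct (Hlim del Hdel) as [t' [[Ut' At'] Hd]].
      exists (wrap t'). split; [assumption|]. now apply H.
    + exists (turn p). pose proof (turn_unit p Hp). split; [unfold unit_interval; lra|].
      rewrite wrap_turn by assumption. tauto.
    + exists y. intros q Aq. apply Hy. pose proof (turn_unit q (HA1 q Aq)).
      split; [unfold unit_interval; lra|]. rewrite wrap_turn; auto.
Qed.

Theorem theorem2p4 (Z : Type) (dZ : Z -> Z -> R)
  (HdZ : is_metric Z dZ) (Hcpt : compact_space Z dZ) (Hne : exists z : Z, True) :
  (exists (X : Type) (dX : X -> X -> R) (e : Z -> X),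
     Peano_graph X dX /\ homeo_sets dZ dX (fun _ => True) (Gr X dX) e) /\
  (forall x y : Z,
     (exists (X : Type) (dX : X -> X -> R) (e : Z -> X),
        Peano_graph X dX /\ homeo_sets dZ dX (fun _ => True) (Gr X dX) e /\
        Eulerian X dX) /\
     (exists (X : Type) (dX : X -> X -> R) (e : Z -> X),
        Peano_graph X dX /\ homeo_sets dZ dX (fun _ => True) (Gr X dX) e /\
        open_Eulerian X dX (e x) (e y))).
Proof.
  split.
  - destruct Hne as [z _].
    destruct (arc_curve_exists Z dZ z z HdZ Hcpt) as [X [dX [e [g [H1 [H2 _]]]]]].
    exists X, dX, e. tauto.
  - intros x y. split.
    + destruct (arc_curve_exists Z dZ x x HdZ Hcpt) as [X [dX [e [g [H1 [H2 [H3 [H4 H5]]]]]]]].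
      exists X, dX, e. split; [assumption|split; [assumption|]].
      apply (closed_curve_Eulerian X dX g); congruence.
    + destruct (arc_curve_exists Z dZ x y HdZ Hcpt) as [X [dX [e [g [H1 [H2 [H3 [H4 H5]]]]]]]].
      exists X, dX, e. split; [assumption|split; [assumption|]]. exists g. auto.
Qed.
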